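(* Let $\alpha\in(0,1)$ and let $\{Z(n),n\ge 0\}$ be a Galton-Watson branching process with $Z(0)=1$ whose offspring number $\xi$ has probability generating function $f(s)=\mathbf{E}s^{\xi}$ satisfying $$\mathbf{E}\xi=1,\qquad f(s)=s+(1-s)^{1+\alpha}L(1-s),\quad 0\le s\le 1,$$ where $L(z)$ is slowly varying as $z\downarrow 0$. Let $f_n$ denote the $n$th iterate of $f$. Let $\varphi(n)>0$, $n=1,2,\ldots$, be a deterministic function such that $\varphi(n)\to\infty$ and $\varphi(n)/n\to 0$ as $n\to\infty$, and put $$\mathcal{H}(n):=\{0<(1-f_{\varphi(n)}(0))Z(n)\le 1\}.$$ Then, as $n\to\infty$, $$\mathbf{P}(\mathcal{H}(n))\sim\frac{1-f_n(0)}{\alpha n}\,\frac{1}{\Gamma(1+\alpha)}\,\varphi(n).$$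
   Context: $\mathbf{E}$ and $\mathbf{P}$ denote expectation and probability. The iterates are $f_0(s)=s$, $f_n(s)=f(f_{n-1}(s))$, $n\ge1$, so that $\mathbf{E}s^{Z(n)}=f_n(s)$ and $1-f_n(0)=\mathbf{P}(Z(n)>0)$. A positive (measurable) function $L$ is slowly varying as $z\downarrow0$ if $L(cz)/L(z)\to1$ as $z\downarrow0$ for every $c>0$; at $s=1$ the term $(1-s)^{1+\alpha}L(1-s)$ is read as $0$. A non-integer index is replaced by its integer part: $f_{\varphi(n)}$ means $f_{\lfloor\varphi(n)\rfloor}$. $a_n\sim b_n$ means $a_n/b_n\to1$. $\Gamma$ is the Gamma function. *)

(* Defs.v *)
From HB Require Import structures.
From mathcomp Require Import all_boot all_order all_algebra finmap.
From mathcomp Require Import all_classical all_reals all_analysis.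

Set Implicit Arguments.
Unset Strict Implicit.
Unset Printing Implicit Defensive.

Import Order.TTheory GRing.Theory Num.Theory.
Import numFieldNormedType.Exports.

Local Open Scope classical_set_scope.
Local Open Scope ring_scope.

Definition Gamma (R : realType) (x : R) : R :=
  Rintegral (@lebesgue_measure R) `]0, +oo[ (fun t => t `^ (x - 1) * expR (- t)).

Definition asymp_equiv (R : realType) (a b : nat -> R) : Prop :=
  a n / b n @[n --> \oo] --> (1 : R).

(* [L] matters only on ]0, 1]; its values elsewhere are junk. *)
Definition slowly_varying_at0 (R : realType) (L : R -> R) : Prop :=
  [/\ forall z : R, 0 < z <= 1 -> 0 < L z,
      measurable_fun (`]0, 1] : set R) L &
      forall c : R, 0 < c -> L (c * z) / L z @[z --> 0^'+] --> (1 : R)].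

Definition mutually_independent (R : realType) (d d' : measure_display)
    (T : measurableType d) (T' : measurableType d') (P : probability T R)
    (I : choiceType) (X : I -> {RV P >-> T'}) : Prop :=
  forall (J : {fset I}) (B : I -> set T'), (forall i, measurable (B i)) ->
    P (\bigcap_(i in [set` J]) (X i @^-1` B i)) =
    (\prod_(i <- J) P (X i @^-1` B i))%E.

Definition identically_distributed (R : realType) (d d' : measure_display)
    (T : measurableType d) (T' : measurableType d') (P : probability T R)
    (X Y : {RV P >-> T'}) : Prop :=
  forall B : set T', measurable B -> distribution P X B = distribution P Y B.

(* [X (n, i)] is the number of children of the [i]-th individual of
   generation [n]. *)
Definition Galton_Watson (R : realType) (d : measure_display)
    (T : measurableType d) (P : probability T R)
    (xi : {RV P >-> nat}) (Z : nat -> {RV P >-> nat}) : Prop :=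
  exists X : nat * nat -> {RV P >-> nat},
    [/\ mutually_independent X,
        forall ni, identically_distributed (X ni) xi,
        forall w, Z 0%N w = 1%N &
        forall n w, Z n.+1 w = (\sum_(i < Z n w) X (n, val i) w)%N].

(* Junk outside [-1, 1] when the expectation diverges. *)
Definition pgf (R : realType) (d : measure_display)
    (T : measurableType d) (P : probability T R)
    (xi : {RV P >-> nat}) (s : R) : R :=
  fine 'E_P[fun w => (s ^+ xi w)%R].

(* [{0 < (1 - f_{phi(n)}(0)) Z(n) <= 1}], the index [phi n] being rounded down. *)
Definition small_population (R : realType) (d : measure_display)
    (T : measurableType d) (P : probability T R)
    (f : R -> R) (Z : nat -> {RV P >-> nat}) (phi : nat -> R) (n : nat) :
    set T :=
  [set w | 0 < (1 - iter (Num.truncn (phi n)) f 0) * (Z n w)%:R <= 1].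

(* Main.v *)
(* Write [1 - f (1 - q) = q (1 - psi q)] with [psi q = q ^ alpha L q]; psi is
   nondecreasing because [(1 - f s) / (1 - s)] is a power series with nonnegative
   coefficients, and it is regularly varying of index alpha. Counting the steps that
   [Q_n = 1 - f_n(0)] spends between consecutive points of a geometric grid gives
   [n psi(Q_n) -> 1 / alpha], hence [Q_n - Q_{n+k} ~ k Q_n / (alpha n)] when
   [k = o(n)] and [Q_{tm} ~ t^{-1/alpha} Q_m]. So with [m = phi(n)],
   [f_n(exp(- lambda Q_m)) - f_n(0)], the Laplace transform at lambda of the law of
   [Q_m Z(n)] restricted to [Z(n) > 0], is equivalent to
   [lambda^{-alpha} m Q_n / (alpha n)]. As [lambda^{-alpha}] is the Laplace
   transform of the measure with distribution function [x^alpha / Gamma(1 + alpha)],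
   Karamata's method, i.e. approximation of the indicator of [x <= 1] by polynomials
   in [exp(- x)] (primitives of Landau kernels), gives the mass of [0 < x <= 1]. *)

Require Import Defs.
From HB Require Import structures.
From mathcomp Require Import all_boot all_order all_algebra finmap.
From mathcomp Require Import all_classical all_reals all_analysis.
From mathcomp Require Import measurable_realfun.
From mathcomp Require Import ring lra zify.

Import Order.TTheory GRing.Theory Num.Theory.
Import numFieldNormedType.Exports.

Set Implicit Arguments.
Unset Strict Implicit.
Unset Printing Implicit Defensive.

Local Open Scope classical_set_scope.
Local Open Scope ring_scope.

(** * Iteration of q (1 - psi q) for a regularly varying psi *)

(** Why the Laplace limit holds: [exp(- lambda Q_m)] is about [1 - lambda Q_m], and [lambda Q_m] is
    about [Q_k] with [k = lambda^(-alpha) m]. So the argument is nearly a point [f_k(0)] of the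
    orbit of 0, [n] further iterations lead to [f_(n+k)(0)], and the difference is nearly
    [Q_n - Q_(n+k)]. Monotonicity of [f] makes this a squeeze between two true orbit points. Why
    primitives of kernels: the limit measure has density proportional to [x^(alpha-1)], singular at
    0. If [H] is the primitive of [K] vanishing at 0, integration by parts turns the integral of
    [H(exp(-x))] against [d(x^alpha)] into that of [x^alpha K(exp(-x)) exp(-x) dx]. When [K] has
    mass one concentrated near [exp(-1)], the latter is close to 1, while [H] is close to the
    indicator of [y >= exp(-1)], i.e. of [x <= 1]. This yields [Gamma(1 + alpha)] directly, and only
    the Laplace parameters 1, 2, 3, ... are needed. *)

Lemma stolz_le (R : realType) (u v : nat -> R) (C C' : R) :
  v n @[n --> \oo] --> +oo -> C < C' ->
  (\forall i \near \oo, u i.+1 - u i <= C * (v i.+1 - v i)) ->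
  \forall i \near \oo, u i <= C' * v i.
Proof.
move=> /cvgryPge voo CC' [N _ HN].
(* Telescoping keeps [u - C * v] below its value at [N]; since [v] diverges, the slack [C' - C]
   eventually absorbs that constant. *)
have Hi i : u (N + i)%N - C * v (N + i)%N <= u N - C * v N.
  elim: i => [|i IH]; first by rewrite addn0.
  have := HN (N + i)%N (leq_addr _ _); rewrite addnS; lra.
near=> i.
have Ni : (N <= i)%N by near: i; exact: nbhs_infty_ge.
have := Hi (i - N)%N; rewrite subnKC// => H1.
have : (u N - C * v N) / (C' - C) <= v i by near: i; exact: voo.
rewrite ler_pdivrMr ?subr_gt0//; lra.
Unshelve. all: by end_near. Qed.

Lemma stolz_ge (R : realType) (u v : nat -> R) (C C' : R) :
  v n @[n --> \oo] --> +oo -> C' < C ->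
  (\forall i \near \oo, C * (v i.+1 - v i) <= u i.+1 - u i) ->
  \forall i \near \oo, C' * v i <= u i.
Proof.
move=> voo CC' H.
suff : \forall i \near \oo, - u i <= (- C') * v i.
  by apply: filterS => i; rewrite mulNr lerN2.
apply: (@stolz_le _ (fun i => - u i) v (- C)) => //; first by rewrite ltrN2.
by apply: filterS H => i; lra.
Qed.

Section Decay.
Context (R : realType) (alpha : R) (psi : R -> R).
Hypothesis alpha_gt0 : 0 < alpha.
Hypothesis psi_gt0 : forall q : R, 0 < q <= 1 -> 0 < psi q.
Hypothesis psi_lt1 : forall q : R, 0 < q <= 1 -> psi q < 1.
Hypothesis psi_le : forall x y : R, 0 < x -> x <= y -> y <= 1 -> psi x <= psi y.
Hypothesis psi_rv : forall c : R, 0 < c ->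
  psi (c * z) / psi z @[z --> 0^'+] --> c `^ alpha.

Definition decay (q : R) : R := q * (1 - psi q).
Definition decay_seq (n : nat) : R := iter n decay 1.
Local Notation Q := decay_seq.

Lemma geometric_cvg0 (c : R) : 0 < c < 1 -> c ^+ n @[n --> \oo] --> 0.
Proof. by move=> /andP[c0 c1]; apply: cvg_expr; rewrite gtr0_norm. Qed.

Lemma psi_rv_seq (u : nat -> R) (c : R) : 0 < c -> (forall n, 0 < u n) ->
  u n @[n --> \oo] --> 0 ->
  psi (c * u n) / psi (u n) @[n --> \oo] --> c `^ alpha.
Proof.
move=> c0 u0 ucv.
by have /cvg_at_rightP := psi_rv c0; exact.
Qed.

Lemma exprn_in01 (c : R) n : 0 < c < 1 -> 0 < c ^+ n <= 1.
Proof.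
by move=> /andP[c0 c1]; rewrite exprn_gt0//= exprn_ile1// ltW.
Qed.

(** Along the powers of 1/2 the ratios of consecutive values tend to 2^(-alpha) < 1, so these values
    decay geometrically; monotonicity extends the limit to every small argument. *)
Lemma psi_cvg0 : psi z @[z --> 0^'+] --> 0.
Proof.
have h2 : 0 < (2^-1 : R) < 1 by lra.
set P := fun i => psi (2^-1 ^+ i).
have P0 i : 0 < P i by apply: psi_gt0; exact: exprn_in01.
have r1 : (2^-1 : R) `^ alpha < 1.
  have E1 : 1 = 1 `^ alpha :> R by rewrite powR1.
  rewrite [ltRHS]E1.
  by have [? ?] := andP h2; apply: gt0_ltr_powR; rewrite ?nnegrE ?ltW.
have Prat : P i.+1 / P i @[i --> \oo] --> (2^-1 : R) `^ alpha.
  rewrite /P; under eq_fun do rewrite exprS.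
  apply: psi_rv_seq; first lra.
  - by move=> n; have /andP[] := exprn_in01 n h2.
  - exact: geometric_cvg0.
set r := ((2^-1 : R) `^ alpha + 1) / 2.
have r01 : 0 < r < 1 by have := powR_ge0 (2^-1 : R) alpha; rewrite /r; lra.
have [N _ HN] : \forall i \near \oo, P i.+1 / P i < r.
  by apply: (cvgr_lt ((2^-1 : R) `^ alpha)) => //; rewrite /r; lra.
have PN i : P (N + i)%N <= r ^+ i * P N.
  elim: i => [|i IH]; first by rewrite addn0 mul1r.
  have := HN (N + i)%N (leq_addr _ _); rewrite /= ltr_pdivrMr// addnS => /ltW H1.
  rewrite exprS; apply: (le_trans H1); rewrite -mulrA ler_pM2l//; lra.
apply/cvgrPdist_lt => e e0.
have [k Hk] : exists k, r ^+ k * P N < e.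
  have : r ^+ k * P N @[k --> \oo] --> 0 * P N.
    by apply: cvgMl; exact: geometric_cvg0.
  rewrite mul0r => /cvgr_lt /(_ _ e0) [k _ Hk]; exists k; exact: (Hk k (leqnn k)).
have /andP[c0 c1] := exprn_in01 (N + k) h2.
near=> z.
have z0 : 0 < z by [].
rewrite sub0r normrN gtr0_norm; last first.
  apply: psi_gt0; rewrite z0/=; apply: le_trans c1.
  by near: z; exact: nbhs_right_le.
apply: le_lt_trans Hk; apply: le_trans (PN k); apply: psi_le => //.
by near: z; exact: nbhs_right_le.
Unshelve. all: by end_near. Qed.

Lemma decay_gt0 q : 0 < q <= 1 -> 0 < decay q.
Proof.
move=> q01; have := psi_lt1 q01; rewrite /decay => ?.
by rewrite mulr_gt0// ?subr_gt0//; case/andP: q01.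
Qed.

Lemma decay_lt q : 0 < q <= 1 -> decay q < q.
Proof.
move=> q01; have /andP[q0 _] := q01; have := psi_gt0 q01; rewrite /decay; nra.
Qed.

Lemma Q_in01 n : 0 < Q n <= 1.
Proof.
elim: n => [|n IH]; first by rewrite /Q /= ltr01 lexx.
rewrite /Q iterS -/(Q n) decay_gt0//=.
by apply: (le_trans (ltW (decay_lt IH))); case/andP: IH.
Qed.

Lemma Q_gt0 n : 0 < Q n. Proof. by have /andP[] := Q_in01 n. Qed.
Lemma Q_le1 n : Q n <= 1. Proof. by have /andP[] := Q_in01 n. Qed.

Lemma QS n : Q n.+1 = Q n * (1 - psi (Q n)). Proof. by []. Qed.

Lemma Q_ltS n : Q n.+1 < Q n. Proof. exact: decay_lt (Q_in01 n). Qed.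

Lemma Q_le m n : (m <= n)%N -> Q n <= Q m.
Proof.
move=> /subnKC <-; elim: (n - m)%N => [|k IH]; first by rewrite addn0.
by rewrite addnS; apply: le_trans IH; exact/ltW/Q_ltS.
Qed.

Lemma psiQ_le m n : (m <= n)%N -> psi (Q n) <= psi (Q m).
Proof. by move=> mn; apply: psi_le; [exact: Q_gt0|exact: Q_le|exact: Q_le1]. Qed.

(** If [Q] stayed above some [e], then [psi (Q n) >= psi e], and each step would shrink [Q] by the
    fixed factor [1 - psi e]. *)
Lemma Q_cvg0 : Q n @[n --> \oo] --> 0.
Proof.
apply/cvgr0Pnorm_lt => e e0.
suff [N QN] : exists N, Q N < e.
  near=> n; rewrite gtr0_norm ?Q_gt0//; apply: le_lt_trans QN; apply: Q_le.
  by near: n; exact: nbhs_infty_ge.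
apply: contrapT => /forallNP H.
have {}H n : e <= Q n by rewrite leNgt; apply/negP/H.
have e01 : 0 < e <= 1 by rewrite e0 (le_trans (H 0%N) (Q_le1 0)).
have pe0 := psi_gt0 e01; have pe1 := psi_lt1 e01.
have Hn n : Q n <= (1 - psi e) ^+ n.
  elim: n => [|n IH]; first by rewrite expr0 Q_le1.
  rewrite QS exprSr; apply: ler_pM => //; first exact/ltW/Q_gt0.
    by rewrite subr_ge0; exact/ltW/psi_lt1/Q_in01.
  by rewrite lerB//; apply: psi_le => //; exact: Q_le1.
have /cvgr_lt /(_ _ e0) [N _ HN] : (1 - psi e) ^+ n @[n --> \oo] --> 0.
  by apply: geometric_cvg0; lra.
have := HN N (leqnn _) => /= HN1.
by have := le_lt_trans (Hn N) HN1; rewrite ltNge H.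
Unshelve. all: by end_near. Qed.

Lemma psi_cvg0_seq (u : nat -> R) : (forall n, 0 < u n) ->
  u n @[n --> \oo] --> 0 -> psi (u n) @[n --> \oo] --> 0.
Proof. by move=> u0 ucv; have /cvg_at_rightP := psi_cvg0; exact. Qed.

Lemma Q_geo_le a k p : p <= 1 ->
  (forall j, (a <= j < a + k)%N -> p <= psi (Q j)) -> Q (a + k) <= Q a * (1 - p) ^+ k.
Proof.
move=> p1; elim: k => [_|k IH H]; first by rewrite addn0 mulr1.
rewrite addnS QS exprSr mulrA; apply: ler_pM.
- exact/ltW/Q_gt0.
- by rewrite subr_ge0; exact/ltW/psi_lt1/Q_in01.
- by apply: IH => j /andP[aj jk]; apply: H; rewrite aj/= addnS ltnS ltnW.
- by rewrite lerB// H// leq_addr/= addnS.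
Qed.

Lemma Q_geo_ge a k p : p <= 1 ->
  (forall j, (a <= j < a + k)%N -> psi (Q j) <= p) -> Q a * (1 - p) ^+ k <= Q (a + k).
Proof.
move=> p1; elim: k => [_|k IH H]; first by rewrite addn0 mulr1.
rewrite addnS QS exprSr mulrA; apply: ler_pM.
- by rewrite mulr_ge0 ?exprn_ge0 ?subr_ge0// ltW// Q_gt0.
- by rewrite subr_ge0.
- by apply: IH => j /andP[aj jk]; apply: H; rewrite aj/= addnS ltnS ltnW.
- by rewrite lerB// H// leq_addr/= addnS.
Qed.

Lemma onem_le_expR (p : R) : 1 - p <= expR (- p).
Proof. exact: expR_ge1Dx. Qed.

(** This is [expR_ge1Dx] at [p / (1 - p)], inverted. Together with [onem_le_expR] it turns powers of
    [1 - p] into exponentials with an error of second order in the exponent. *)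
Lemma onem_ge_expR (p : R) : p < 1 -> expR (- (p / (1 - p))) <= 1 - p.
Proof.
move=> p1; have p0 : 0 < 1 - p by rewrite subr_gt0.
rewrite expRN -[leRHS]invrK lef_pV2 ?posrE ?expR_gt0 ?invr_gt0//.
apply: le_trans (expR_ge1Dx _); rewrite le_eqVlt; apply/orP; left; apply/eqP.
by field; rewrite gt_eqF.
Qed.

(** * Crossing times of the geometric grid [c ^+ i] *)

Section Grid.
Variable c : R.
Hypothesis c01 : 0 < c < 1.

Local Notation P := (fun i => psi (c ^+ i)).

Lemma c_gt0 : 0 < c. Proof. by case/andP: c01. Qed.

Lemma grid_gt0 i : 0 < c ^+ i. Proof. by rewrite exprn_gt0// c_gt0. Qed.

Lemma grid_le1 i : c ^+ i <= 1. Proof. by have /andP[] := exprn_in01 i c01. Qed.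

Lemma P_gt0 i : 0 < P i. Proof. exact/psi_gt0/exprn_in01. Qed.

Lemma P_lt1 i : P i < 1. Proof. exact/psi_lt1/exprn_in01. Qed.

Lemma P_cvg0 : P i @[i --> \oo] --> 0.
Proof. by apply: psi_cvg0_seq; [exact: grid_gt0|exact: geometric_cvg0]. Qed.

Lemma P_ratio : P i.+1 / P i @[i --> \oo] --> c `^ alpha.
Proof.
under eq_fun do rewrite exprS.
by apply: psi_rv_seq; [exact: c_gt0|exact: grid_gt0|exact: geometric_cvg0].
Qed.

Lemma hit_ex i : exists n, Q n <= c ^+ i.
Proof.
have /cvgr_lt /(_ _ (grid_gt0 i)) [N _ HN] := Q_cvg0.
by exists N; exact/ltW/(HN N (leqnn N)).
Qed.

Definition hit (i : nat) : nat := ex_minn (hit_ex i).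

Lemma Q_hit i : Q (hit i) <= c ^+ i.
Proof. by rewrite /hit; case: ex_minnP. Qed.

Lemma hit_leP i n : (hit i <= n)%N = (Q n <= c ^+ i).
Proof.
apply/idP/idP => [hn|]; first exact: le_trans (Q_le hn) (Q_hit i).
by rewrite /hit; case: ex_minnP => m _; apply.
Qed.

Lemma hit_leS i : (hit i <= hit i.+1)%N.
Proof.
rewrite hit_leP; apply: le_trans (Q_hit _) _; rewrite exprS.
have := grid_gt0 i; case/andP: c01; nra.
Qed.

Lemma hit_cvg : hit i @[i --> \oo] --> \oo.
Proof.
apply/cvgnyPge => n.
have /cvgr_lt /(_ _ (Q_gt0 n)) := geometric_cvg0 c01.
apply: filterS => i ci; rewrite leqNgt; apply/negP => /ltnW/Q_le.
by rewrite leNgt (le_lt_trans (Q_hit i) ci).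
Qed.

(* Bounds the relative overshoot of [Q (hit i)] below [c ^+ i]. *)
Local Notation e := (fun i => psi (Q (hit i).-1)).

Lemma e_lt1 i : e i < 1. Proof. exact/psi_lt1/Q_in01. Qed.

Lemma e_cvg0 : e i @[i --> \oo] --> 0.
Proof.
have cv : (hit i).-1 @[i --> \oo] --> \oo.
  apply/cvgnyPge => n; have /cvgnyPge/(_ n.+1) := hit_cvg.
  by apply: filterS => i; case: (hit i).
by apply: (cvg_comp _ (psi \o Q) cv); exact: psi_cvg0_seq Q_gt0 Q_cvg0.
Qed.

Lemma ratio_cvg0 (u : nat -> R) : u i @[i --> \oo] --> 0 ->
  u i / (1 - u i) @[i --> \oo] --> 0.
Proof.
move=> u0; have -> : 0 = 0 / (1 - 0) :> R by rewrite mul0r.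
apply: cvgM => //; apply: cvgV; first by rewrite subr0 oner_eq0.
by apply: cvgB => //; exact: cvg_cst.
Qed.

(** Just before the crossing [Q] still exceeds [c ^+ i], and one step multiplies it by [1 - e i]. *)
Lemma Q_hit_ge i : c ^+ i * (1 - e i) <= Q (hit i).
Proof.
(* If [hit i = 0] there is no previous step and [.-1] returns 0; then [Q 0 = 1] makes the bound
   trivial. *)
have [h0|h0] := posnP (hit i).
  rewrite h0 -[leRHS]/(1 : R) -[leRHS](mulr1 1).
  apply: ler_pM; rewrite ?grid_le1 ?(ltW (grid_gt0 _)) ?subr_ge0//.
    exact/ltW/psi_lt1/Q_in01.
  by rewrite lerBlDr lerDl; exact/ltW/psi_gt0/Q_in01.
rewrite -{2}(prednK h0) QS ler_pM2r ?subr_gt0 ?e_lt1//.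
by apply/ltW; rewrite ltNge -hit_leP -ltnNge prednK.
Qed.

Local Notation l := (- ln c).

(** Before level [i.+1] is crossed, [Q] exceeds [c ^+ i.+1], so each step multiplies it by at most
    [1 - P i.+1]; over the whole cell it is multiplied by at least [c * (1 - e i.+1)]. Compare
    exponents. *)
Lemma grid_step_le i :
  (hit i.+1 - hit i)%:R * P i.+1 <= l + e i.+1 / (1 - e i.+1).
Proof.
set D := (hit i.+1 - hit i)%N.
have H1 : Q (hit i.+1) <= Q (hit i) * (1 - P i.+1) ^+ D.
  rewrite -[X in Q X <= _](subnKC (hit_leS i)); apply: Q_geo_le; first exact/ltW/P_lt1.
  move=> j /andP[_]; rewrite subnKC ?hit_leS// => jh.
  apply: psi_le; [exact: grid_gt0| |exact: Q_le1].
  by apply/ltW; rewrite ltNge -hit_leP -ltnNge.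
have H2 : (1 - P i.+1) ^+ D <= expR (- (D%:R * P i.+1)).
  rewrite -mulrN mulrC expRM_natr lerXn2r ?nnegrE ?expR_ge0 ?subr_ge0 ?(ltW (P_lt1 _))//.
  exact: onem_le_expR.
have H3 : c * (1 - e i.+1) <= expR (- (D%:R * P i.+1)).
  rewrite -(ler_pM2l (grid_gt0 i)) mulrA -exprSr.
  apply: (le_trans (Q_hit_ge _)); apply: (le_trans H1); apply: ler_pM => //.
  - exact/ltW/Q_gt0.
  - by rewrite exprn_ge0// subr_ge0 ltW// P_lt1.
  - exact: Q_hit.
have : expR (- (l + e i.+1 / (1 - e i.+1))) <= expR (- (D%:R * P i.+1)).
  apply: le_trans H3; rewrite opprD opprK expRD lnK ?posrE ?c_gt0// ler_pM2l ?c_gt0//.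
  exact/onem_ge_expR/e_lt1.
by rewrite ler_expR lerN2.
Qed.

(** The mirror estimate: after level [i] is crossed a step multiplies [Q] by at least [1 - P i], and
    the overshoot at the start costs at most [1 - e i]. The factor [1 - P i] on the left comes from
    [onem_ge_expR]. *)
Lemma grid_step_ge i :
  (l - e i / (1 - e i)) * (1 - P i) <= (hit i.+1 - hit i)%:R * P i.
Proof.
set D := (hit i.+1 - hit i)%N.
have P1 : 0 < 1 - P i by rewrite subr_gt0 P_lt1.
have H1 : Q (hit i) * (1 - P i) ^+ D <= Q (hit i.+1).
  rewrite -[X in _ <= Q X](subnKC (hit_leS i)); apply: Q_geo_ge; first exact/ltW/P_lt1.
  move=> j /andP[hj _]; apply: psi_le; [exact: Q_gt0| |exact: grid_le1].
  by rewrite -hit_leP.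
have H2 : expR (- (D%:R * (P i / (1 - P i)))) <= (1 - P i) ^+ D.
  rewrite -mulrN mulrC expRM_natr lerXn2r ?nnegrE ?expR_ge0 ?(ltW P1)//.
  exact/onem_ge_expR/P_lt1.
have H3 : (1 - e i) * expR (- (D%:R * (P i / (1 - P i)))) <= c.
  rewrite -(ler_pM2l (grid_gt0 i)) -exprSr [leLHS]mulrA.
  apply: le_trans (Q_hit i.+1); apply: le_trans H1; apply: ler_pM => //.
  - apply: mulr_ge0; first exact/ltW/grid_gt0.
    by rewrite subr_ge0; exact/ltW/e_lt1.
  - exact: Q_hit_ge.
have : expR (- (e i / (1 - e i)) - (D%:R * (P i / (1 - P i)))) <= expR (- l).
  rewrite expRD opprK lnK ?posrE ?c_gt0//; apply: le_trans H3.
  by rewrite ler_pM2r ?expR_gt0//; exact/onem_ge_expR/e_lt1.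
rewrite ler_expR => H4; rewrite -ler_pdivlMr//; move: H4; rewrite !mulrA; lra.
Qed.

Local Notation r := (c `^ alpha).

Lemma r_gt0 : 0 < r. Proof. exact/powR_gt0/c_gt0. Qed.

Lemma r_lt1 : r < 1.
Proof.
have E1 : 1 = 1 `^ alpha :> R by rewrite powR1.
rewrite [ltRHS]E1; have [? ?] := andP c01.
by apply: gt0_ltr_powR; rewrite ?nnegrE ?ltW.
Qed.

Lemma invP_cvg : (P i)^-1 @[i --> \oo] --> +oo.
Proof.
apply/cvgryPge => A.
have A0 : 0 < (1 + `|A|)^-1 by rewrite invr_gt0 ltr_pwDl.
have /cvgr_le /(_ _ A0) := P_cvg0; apply: filterS => i.
rewrite -[leLHS]invrK lef_pV2 ?posrE ?invr_gt0 ?ltr_pwDl// ?P_gt0// => H.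
by apply: le_trans H; rewrite (le_trans (ler_norm _))// lerDr.
Qed.

(** Stolz with [v i = (P i)^-1]: a cell takes at most about [l / P i.+1] steps, and [v] grows over
    it by about [(1 - r) / P i.+1]. *)
Lemma hit_le u : l / (1 - r) < u -> \forall i \near \oo, (hit i)%:R <= u * (P i)^-1.
Proof.
move=> lu; set C := (l / (1 - r) + u) / 2.
have r1 : 0 < 1 - r by rewrite subr_gt0 r_lt1.
apply: (@stolz_le _ _ _ C u invP_cvg); first by rewrite /C; lra.
have cv : C * (1 - P i.+1 / P i) - (l + e i.+1 / (1 - e i.+1)) @[i --> \oo] -->
    C * (1 - r) - (l + 0).
  apply: cvgB; first apply: cvgMr; first apply: cvgB; first exact: cvg_cst.
    exact: P_ratio.
  apply: cvgD; first exact: cvg_cst.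
  apply: ratio_cvg0; exact: (cvg_comp _ e (@cvg_addnl 1%N) e_cvg0).
have /(cvgr_gt _ cv) : 0 < C * (1 - r) - (l + 0).
  by rewrite addr0 subr_gt0 -ltr_pdivrMr// /C; lra.
apply: filterS => i H.
rewrite -natrB ?hit_leS// -(ler_pM2r (P_gt0 i.+1)).
apply: (le_trans (grid_step_le i)).
rewrite -mulrA mulrBl mulVf ?gt_eqF ?P_gt0// [_^-1 * _]mulrC; lra.
Qed.

(** A cell takes at least about [l / P i] steps, while [(P i)^-1] grows by about
    [(1 - r) / r / P i]; hence the extra [r] compared with [hit_le]. *)
Lemma hit_ge u : u < l * r / (1 - r) -> \forall i \near \oo, u * (P i)^-1 <= (hit i)%:R.
Proof.
move=> lu; set C := (l * r / (1 - r) + u) / 2.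
have r0 := r_gt0.
have r1 : 0 < 1 - r by rewrite subr_gt0 r_lt1.
apply: (@stolz_ge _ _ _ C u invP_cvg); first by rewrite /C; lra.
have cv : (l - e i / (1 - e i)) * (1 - P i) - C * ((P i.+1 / P i)^-1 - 1)
   @[i --> \oo] --> (l - 0) * (1 - 0) - C * (r^-1 - 1).
  apply: cvgB; last first.
    apply: cvgMr; apply: cvgB; last exact: cvg_cst.
    by apply: cvgV; [rewrite gt_eqF|exact: P_ratio].
  apply: cvgM; (apply: cvgB; first exact: cvg_cst); last exact: P_cvg0.
  exact: ratio_cvg0 e_cvg0.
have /(cvgr_gt _ cv) : 0 < (l - 0) * (1 - 0) - C * (r^-1 - 1).
  have -> : r^-1 - 1 = (1 - r) / r by field; rewrite gt_eqF.
  rewrite !subr0 mulr1 subr_gt0 mulrA ltr_pdivrMr// -ltr_pdivlMr// /C; lra.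
apply: filterS => i H.
rewrite -natrB ?hit_leS// -(ler_pM2r (P_gt0 i)).
apply: le_trans (grid_step_ge i).
rewrite -mulrA mulrBl mulVf ?gt_eqF ?P_gt0//; move: H; rewrite invf_div [P i / _]mulrC; lra.
Qed.

(** The index [i] is that of the cell [c ^+ i.+1 < Q n <= c ^+ i]: the predecessor of the least [k]
    with [c ^+ k < Q n], which is positive because [Q n <= 1]. *)
Lemma locate N n : (hit N <= n)%N -> exists i,
  [/\ (N <= i)%N, (hit i <= n)%N, (n <= hit i.+1)%N,
      P i.+1 <= psi (Q n) & psi (Q n) <= P i].
Proof.
move=> hn.
have ex : exists k, c ^+ k < Q n.
  have /cvgr_lt /(_ _ (Q_gt0 n)) [k _ Hk] := geometric_cvg0 c01.
  by exists k; exact: (Hk k (leqnn k)).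
have := ex_minnP ex; case=> -[|i] ci mi.
  by move: ci; rewrite expr0 ltNge Q_le1.
have ni : Q n <= c ^+ i.
  by rewrite leNgt; apply/negP => /mi; rewrite ltnn.
exists i; split.
- rewrite -ltnS ltnNge; apply/negP => iN.
  move: ci; rewrite ltNge; apply/negP/negPn.
  have : Q n <= c ^+ N by rewrite -hit_leP.
  move/le_trans; apply; apply: ler_wiXn2l => //; case/andP: c01 => /ltW ? /ltW ? //.
- by rewrite hit_leP.
- by apply/ltnW; rewrite ltnNge hit_leP -ltNge.
- by apply: psi_le; [exact: grid_gt0|exact: ltW|exact: Q_le1].
- by apply: psi_le; [exact: Q_gt0| |exact: grid_le1].
Qed.

(** In cell [i] the available bounds are [n <= hit i.+1] and [psi (Q n) <= P i]; the mismatched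
    indices cost the ratio [P i / P i.+1], which tends to [r^-1]. *)
Lemma npsi_le u : l / (1 - r) / r < u -> \forall n \near \oo, n%:R * psi (Q n) <= u.
Proof.
have r0 := r_gt0.
have r1 : 0 < 1 - r by rewrite subr_gt0 r_lt1.
rewrite ltr_pdivrMr// => lu; set C := (l / (1 - r) + u * r) / 2.
have cv : C * (P i.+1 / P i)^-1 @[i --> \oo] --> C * r^-1.
  by apply: cvgMr; apply: cvgV; [rewrite gt_eqF|exact: P_ratio].
have /(cvgr_lt _ cv) [N1 _ HN1] : C * r^-1 < u by rewrite ltr_pdivrMr// /C; lra.
have /hit_le [N2 _ HN2] : l / (1 - r) < C by rewrite /C; lra.
near=> n.
have [|i [Ni _ ni _ Pi]] := @locate (maxn N1 N2) n.
  by near: n; exact: nbhs_infty_ge.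
have := HN1 i (leq_trans (leq_maxl _ _) Ni); rewrite /= invf_div => h1.
have /= h2 := HN2 i.+1 (leq_trans (leq_trans (leq_maxr _ _) Ni) (leqnSn _)).
apply: le_trans (ltW h1); rewrite mulrA [C * _ / _]mulrAC.
apply: ler_pM => //; first exact/ltW/psi_gt0/Q_in01.
by apply: le_trans h2; rewrite ler_nat.
Unshelve. all: by end_near. Qed.

(** Here the bounds are [hit i <= n] and [P i.+1 <= psi (Q n)], and the mismatch costs a factor
    [r]. *)
Lemma npsi_ge u : 0 < u -> u < l * r / (1 - r) * r ->
  \forall n \near \oo, u <= n%:R * psi (Q n).
Proof.
have r0 := r_gt0.
have r1 : 0 < 1 - r by rewrite subr_gt0 r_lt1.
rewrite -ltr_pdivrMr// => u0 lu; set C := (l * r / (1 - r) + u / r) / 2.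
have cv : C * (P i.+1 / P i) @[i --> \oo] --> C * r.
  by apply: cvgMr; exact: P_ratio.
have /(cvgr_gt _ cv) [N1 _ HN1] : u < C * r by rewrite -ltr_pdivrMr// /C; lra.
have /hit_ge [N2 _ HN2] : C < l * r / (1 - r) by rewrite /C; lra.
near=> n.
have [|i [Ni ni _ Pi _]] := @locate (maxn N1 N2) n.
  by near: n; exact: nbhs_infty_ge.
have /= h1 := HN1 i (leq_trans (leq_maxl _ _) Ni).
have /= h2 := HN2 i (leq_trans (leq_maxr _ _) Ni).
apply: (le_trans (ltW h1)); rewrite mulrA [C * _ / _]mulrAC.
apply: ler_pM => //; last first.
- by apply: (le_trans h2); rewrite ler_nat.
- exact/ltW/P_gt0.
- by apply: divr_ge0; [have := divr_gt0 u0 r0; rewrite /C; lra|exact/ltW/P_gt0].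
Unshelve. all: by end_near. Qed.

End Grid.

(* As [c] tends to [1], the bounds of [npsi_le] and [npsi_ge] both tend to
   [alpha^-1]. *)
Lemma npsi_cvg : n%:R * psi (Q n) @[n --> \oo] --> alpha^-1.
Proof.
apply/cvgrPdist_le => eps eps0.
have a0 := alpha_gt0.
(* With [c = expR (- (h / alpha))] one gets [l = h / alpha] and [r = expR (- h)], so the two bounds
   are [alpha^-1] times [h / (1 - r) / r] and [h * r / (1 - r) * r], both within a multiple of [h]
   of [alpha^-1]. The divisor 8 leaves room for these multiples. *)
set h := Num.min (4^-1) (alpha * eps / 8).
have ae0 : 0 < alpha * eps by exact: mulr_gt0.
have h0 : 0 < h by rewrite lt_min; apply/andP; split; lra.
have h4 : h <= 4^-1 by rewrite ge_min lexx.
have he : 8 * h <= alpha * eps.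
  have : h <= alpha * eps / 8 by rewrite ge_min lexx orbT.
  lra.
set c := expR (- (h / alpha)).
have ha0 : 0 < h / alpha by rewrite divr_gt0.
have c01 : 0 < c < 1 by rewrite expR_gt0 expR_lt1 oppr_lt0.
have lE : - ln c = h / alpha by rewrite /c expRK opprK.
have rE : c `^ alpha = expR (- h).
  by rewrite -expRM mulNr mulfVK// gt_eqF.
set r := expR (- h) in rE.
have r0 : 0 < r by exact: expR_gt0.
have r1 : 0 < 1 - r by rewrite subr_gt0 expR_lt1 oppr_lt0.
have rh : 1 - h <= r by exact: onem_le_expR.
have hr : h <= (1 + h) * (1 - r).
  have : (1 + h) * r <= 1.
    rewrite /r expRN ler_pdivrMr ?expR_gt0// mul1r; exact: expR_ge1Dx.
  lra.
have r2h : (1 - h) * (1 - h) <= r * r by apply: ler_pM => //; lra.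
have up : h / (1 - r) / r < 1 + alpha * eps.
  rewrite -mulrA -invfM ltr_pdivrMr ?mulr_gt0//.
  set S := alpha * eps in ae0 he *; have h10 : 0 < 1 + h by lra.
  rewrite -(ltr_pM2r h10).
  have A : h * (1 + h) < (1 + S) * (h * (1 - h)).
    rewrite [ltRHS]mulrCA ltr_pM2l//.
    have : 8 * h * (1 - h) <= S * (1 - h) by rewrite ler_pM2r//; lra.
    have : h * h <= h * 4^-1 by rewrite ler_pM2l.
    lra.
  apply: (lt_le_trans A); rewrite -mulrA ler_pM2l; last by lra.
  have B : h * (1 - h) <= (1 + h) * (1 - r) * r by apply: ler_pM => //; lra.
  by apply: (le_trans B); rewrite le_eqVlt; apply/orP; left; apply/eqP; ring.
have lo : 1 - alpha * eps < h * r / (1 - r) * r.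
  rewrite mulrAC ltr_pdivlMr//.
  set S := alpha * eps in ae0 he *.
  have A : (1 - S) * (1 - r) <= (1 - 4 * h) * h.
    apply: (@le_trans _ _ ((1 - 4 * h) * (1 - r))); first by rewrite ler_pM2r//; lra.
    by apply: ler_wpM2l; lra.
  apply: (le_lt_trans A); rewrite -mulrA mulrC ltr_pM2l//; nra.
have Hup : \forall n \near \oo, n%:R * psi (Q n) <= alpha^-1 + eps.
  apply: (npsi_le c01); rewrite lE rE.
  rewrite (_ : h / alpha / (1 - r) / r = h / (1 - r) / r / alpha); last first.
    by field; rewrite !gt_eqF.
  rewrite ltr_pdivrMr// mulrDl mulVf ?gt_eqF// [eps * _]mulrC; exact: up.
have Hlo : \forall n \near \oo, alpha^-1 - eps <= n%:R * psi (Q n).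
  (* [npsi_ge] needs a positive lower bound; for larger [eps] nonnegativity is enough. *)
  have [ge|lt] := leP (alpha^-1) eps.
    apply: nearW => n; apply: (@le_trans _ _ 0); first by rewrite subr_le0.
    by rewrite mulr_ge0// ltW// psi_gt0// Q_in01.
  apply: (npsi_ge c01); first by rewrite subr_gt0.
  rewrite lE rE.
  rewrite (_ : h / alpha * r / (1 - r) * r = h * r / (1 - r) * r / alpha); last first.
    by field; rewrite !gt_eqF.
  rewrite ltr_pdivlMr// mulrBl mulVf ?gt_eqF// [eps * _]mulrC; exact: lo.
near=> n; rewrite ler_distlC; apply/andP; split.
  by near: n.
by near: n.
Unshelve. all: by end_near. Qed.

(** The decrements [Q j * psi (Q j)] decrease with [j], so the first one dominates them all;
    [Q_sub_ge] bounds them below by the value at [n + k]. *)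
Lemma Q_sub_le n k : Q n - Q (n + k) <= k%:R * (Q n * psi (Q n)).
Proof.
elim: k => [|k IH]; first by rewrite addn0 subrr mul0r.
rewrite addnS QS -natr1 mulrDl mul1r.
have : Q (n + k) * psi (Q (n + k)) <= Q n * psi (Q n).
  apply: ler_pM; rewrite ?(ltW (Q_gt0 _))//.
  - exact/ltW/psi_gt0/Q_in01.
  - exact/Q_le/leq_addr.
  - exact/psiQ_le/leq_addr.
lra.
Qed.

Lemma Q_sub_ge n k : k%:R * (Q (n + k) * psi (Q (n + k))) <= Q n - Q (n + k).
Proof.
elim: k n => [|k IH] n; first by rewrite addn0 subrr mul0r.
rewrite -addSnnS -natr1 mulrDl mul1r.
have : Q (n.+1 + k) * psi (Q (n.+1 + k)) <= Q n * psi (Q n).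
  apply: ler_pM; rewrite ?(ltW (Q_gt0 _))//.
  - exact/ltW/psi_gt0/Q_in01.
  - by apply: Q_le; lia.
  - by apply: psiQ_le; lia.
have := IH n.+1; have := QS n; nra.
Qed.

Lemma psiQ_gt0 n : 0 < psi (Q n). Proof. exact/psi_gt0/Q_in01. Qed.

(** * Decrements of [Q] over [k n = o(n)] steps *)

Section Increment.
Variable k : nat -> nat.
Hypothesis k_gt0 : \forall n \near \oo, (0 < k n)%N.
Hypothesis k_small : (k n)%:R / n%:R @[n --> \oo] --> (0 : R).

(** [j * psi (Q j)] has the same limit along [n] and along [n + k n], and [(n + k n) / n] tends to
    1. *)
Lemma psiQ_shift_cvg : psi (Q (n + k n)) / psi (Q n) @[n --> \oo] --> (1 : R).
Proof.
have a0 : alpha^-1 != 0 by rewrite invr_eq0 gt_eqF.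
have cv1 : (n + k n)%:R * psi (Q (n + k n)) @[n --> \oo] --> alpha^-1.
  have sh : (n + k n)%N @[n --> \oo] --> \oo.
    apply/cvgnyPge => N; near=> n; apply: leq_trans (leq_addr _ _).
    by near: n; exact: nbhs_infty_ge.
  exact: (cvg_comp _ (fun n => n%:R * psi (Q n)) sh npsi_cvg).
have cv : ((n + k n)%:R * psi (Q (n + k n))) / (n%:R * psi (Q n)) / (1 + (k n)%:R / n%:R)
   @[n --> \oo] --> alpha^-1 / alpha^-1 / (1 + 0).
  apply: cvgM; last first.
    by apply: cvgV; [rewrite addr0 oner_eq0|apply: cvgD => //; exact: cvg_cst].
  apply: cvgM => //; apply: cvgV => //; exact: npsi_cvg.
rewrite addr0 divff// divr1 in cv.
apply: cvg_trans cv; apply: near_eq_cvg; near=> n.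
have n0 : 0 < n%:R :> R by rewrite ltr0n; near: n; exact: nbhs_infty_gt.
have k0 : 0 <= (k n)%:R :> R by [].
have p0 := psiQ_gt0 n.
rewrite natrD; field; rewrite !gt_eqF//; lra.
Unshelve. all: by end_near. Qed.

Lemma Q_sub_cvg :
  (Q n - Q (n + k n)) / (Q n / (alpha * n%:R) * (k n)%:R) @[n --> \oo] --> (1 : R).
Proof.
have a0 := alpha_gt0.
have cv : (Q n - Q (n + k n)) / ((k n)%:R * (Q n * psi (Q n))) @[n --> \oo] --> (1 : R).
  (* The lower bound combines [Q_sub_ge] with [Q (n + k n) / Q n >= 1 - k n * psi (Q n)], from
     [Q_sub_le]; the product is written through [n * psi (Q n)], whose limit is known. *)
  apply: (@squeeze_cvgr _ _ _ _
     (fun n => (1 - (k n)%:R / n%:R * (n%:R * psi (Q n))) * (psi (Q (n + k n)) / psi (Q n)))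
     (fun=> 1)); last 2 first.
  - rewrite -[X in _ --> X](_ : (1 - 0 * alpha^-1) * 1 = 1); last first.
      by rewrite mul0r subr0 mulr1.
    apply: cvgM; last exact: psiQ_shift_cvg.
    apply: cvgB; first exact: cvg_cst.
    by apply: cvgM => //; exact: npsi_cvg.
  - exact: cvg_cst.
  near=> n.
  have n0 : 0 < n%:R :> R by rewrite ltr0n; near: n; exact: nbhs_infty_gt.
  have k0 : 0 < (k n)%:R :> R by rewrite ltr0n; near: n.
  have p0 := psiQ_gt0 n; have q0 := Q_gt0 n.
  have d0 : 0 < (k n)%:R * (Q n * psi (Q n)) by rewrite !mulr_gt0.
  rewrite ler_pdivrMr// mul1r Q_sub_le andbT ler_pdivlMr//.
  apply: le_trans (Q_sub_ge n (k n)).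
  have -> : (1 - (k n)%:R / n%:R * (n%:R * psi (Q n))) * (psi (Q (n + k n)) / psi (Q n)) *
    ((k n)%:R * (Q n * psi (Q n))) =
    (k n)%:R * ((Q n - (k n)%:R * (Q n * psi (Q n))) * psi (Q (n + k n))).
    by field; rewrite !gt_eqF.
  rewrite ler_pM2l// ler_pM2r ?psiQ_gt0//; have := Q_sub_le n (k n); lra.
have : (Q n - Q (n + k n)) / ((k n)%:R * (Q n * psi (Q n))) * (alpha * (n%:R * psi (Q n)))
   @[n --> \oo] --> 1 * (alpha * alpha^-1).
  by apply: cvgM => //; apply: cvgMr; exact: npsi_cvg.
rewrite mul1r divff ?gt_eqF//; apply: cvg_trans; apply: near_eq_cvg; near=> n.
have n0 : 0 < n%:R :> R by rewrite ltr0n; near: n; exact: nbhs_infty_gt.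
have k0 : 0 < (k n)%:R :> R by rewrite ltr0n; near: n.
have p0 := psiQ_gt0 n; have q0 := Q_gt0 n.
by field; rewrite !gt_eqF.
Unshelve. all: by end_near. Qed.

End Increment.

Lemma truncn_scale_cvg (t : R) : 0 < t ->
  (Num.truncn (t * n%:R))%:R / n%:R @[n --> \oo] --> t.
Proof.
move=> t0; apply: (@squeeze_cvgr _ _ _ _ (fun n => t - n%:R^-1) (fun=> t)); last 2 first.
- rewrite -[X in _ --> X]subr0; apply: cvgB; first exact: cvg_cst.
  apply/(gtr0_cvgV0 _ (f := fun n : nat => n%:R : R)); last exact: cvgr_idn.
  by apply: filterS (nbhs_infty_gt 0%N) => n; rewrite ltr0n.
- exact: cvg_cst.
near=> n.
have n0 : 0 < n%:R :> R by rewrite ltr0n; near: n; exact: nbhs_infty_gt.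
have tn0 : 0 <= t * n%:R by rewrite mulr_ge0// ltW.
have /andP[h1 h2] := truncn_itv tn0.
rewrite ler_pdivrMr// h1 andbT ler_pdivlMr// mulrBl mulVf ?gt_eqF//.
by rewrite lerBlDr natr1 ltW.
Unshelve. all: by end_near. Qed.

Lemma truncn_scale_y (t : R) : 0 < t -> Num.truncn (t * n%:R) @[n --> \oo] --> \oo.
Proof.
move=> t0; apply/cvgnyPge => N.
have /cvgryPge/(_ (N%:R / t)) := @cvgr_idn R; apply: filterS => n.
by rewrite ler_pdivrMr// mulrC => h; rewrite truncn_ge_nat// mulr_ge0// ltW.
Qed.

(** As [j * psi (Q j)] has the same limit along [m] and along [t * m], passing from [Q m] to [Q] at
    [t * m] asymptotically divides [psi] by [t]; scaling [Q m] by [c] multiplies it by [c] to the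
    power [alpha]. *)
Lemma psiQ_scale_cvg (t c : R) : 0 < t -> 0 < c ->
  psi (Q (Num.truncn (t * m%:R))) / psi (c * Q m) @[m --> \oo] --> (t * c `^ alpha)^-1.
Proof.
move=> t0 c0; have a0 := alpha_gt0.
pose T m := Num.truncn (t * m%:R).
have cv1 : (T m)%:R * psi (Q (T m)) @[m --> \oo] --> alpha^-1.
  exact: (cvg_comp _ (fun n => n%:R * psi (Q n)) (truncn_scale_y t0) npsi_cvg).
have ca0 : c `^ alpha != 0 by rewrite gt_eqF// powR_gt0.
have cv : ((T m)%:R * psi (Q (T m))) / (m%:R * psi (Q m)) /
   ((T m)%:R / m%:R * (psi (c * Q m) / psi (Q m)))
   @[m --> \oo] --> alpha^-1 / alpha^-1 / (t * c `^ alpha).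
  apply: cvgM; last first.
    apply: cvgV; first by rewrite mulf_neq0// gt_eqF.
    by apply: cvgM; [exact: truncn_scale_cvg|exact: psi_rv_seq c0 Q_gt0 Q_cvg0].
  apply: cvgM => //; apply: cvgV; first by rewrite invr_eq0 gt_eqF.
  exact: npsi_cvg.
rewrite divff ?invr_eq0 ?gt_eqF// mul1r in cv.
apply: cvg_trans cv; apply: near_eq_cvg; near=> n.
have n0 : 0 < n%:R :> R by rewrite ltr0n; near: n; exact: nbhs_infty_gt.
have T0 : 0 < (T n)%:R :> R.
  by rewrite ltr0n; near: n; have /cvgnyPge/(_ 1%N) := truncn_scale_y t0.
have p0 := psiQ_gt0 n; have p1 := psiQ_gt0 (T n).
have p2 : 0 < psi (c * Q n).
  apply: psi_gt0; rewrite mulr_gt0 ?Q_gt0//=.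
  near: n; have : c * Q n @[n --> \oo] --> c * 0 by apply: cvgMr; exact: Q_cvg0.
  by rewrite mulr0 => /cvgr_le; apply.
by rewrite -/(T n); field; rewrite !gt_eqF.
Unshelve. all: by end_near. Qed.

(** Monotonicity inverts [psi]: if [Q] at [t * m] exceeded [c * Q m], the quotient of the [psi]
    values would be at least 1, against a limit below 1. *)
Lemma Q_scale_le (t c : R) : 0 < t -> 0 < c -> 1 < t * c `^ alpha ->
  \forall m \near \oo, Q (Num.truncn (t * m%:R)) <= c * Q m.
Proof.
move=> t0 c0 tc.
have cv := psiQ_scale_cvg t0 c0.
have tc0 : 0 < t * c `^ alpha by exact: lt_trans tc.
have /(cvgr_lt _ cv) H : (t * c `^ alpha)^-1 < 1 by rewrite invf_lt1.
near=> m; rewrite leNgt; apply/negP => h.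
have cq0 : 0 < c * Q m by rewrite mulr_gt0// Q_gt0.
have := psi_le cq0 (ltW h) (Q_le1 _).
rewrite leNgt => /negP; apply.
have : psi (Q (Num.truncn (t * m%:R))) / psi (c * Q m) < 1 by near: m.
rewrite ltr_pdivrMr ?mul1r// psi_gt0// cq0/= (le_trans (ltW h))// Q_le1.
Unshelve. all: by end_near. Qed.

Lemma Q_scale_ge (t c : R) : 0 < t -> 0 < c -> t * c `^ alpha < 1 ->
  \forall m \near \oo, c * Q m <= Q (Num.truncn (t * m%:R)).
Proof.
move=> t0 c0 tc.
have cv := psiQ_scale_cvg t0 c0.
have tc0 : 0 < t * c `^ alpha by rewrite mulr_gt0// powR_gt0.
have /(cvgr_gt _ cv) H : 1 < (t * c `^ alpha)^-1 by rewrite invf_gt1.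
near=> m; rewrite leNgt; apply/negP => h.
have cq0 : 0 < c * Q m by rewrite mulr_gt0// Q_gt0.
have cq1 : c * Q m <= 1.
  near: m; have : c * Q n @[n --> \oo] --> c * 0 by apply: cvgMr; exact: Q_cvg0.
  by rewrite mulr0 => /cvgr_le; apply.
have := psi_le (Q_gt0 _) (ltW h) cq1.
rewrite leNgt => /negP; apply.
have : 1 < psi (Q (Num.truncn (t * m%:R))) / psi (c * Q m) by near: m.
by rewrite ltr_pdivlMr ?mul1r// psi_gt0// cq0.
Unshelve. all: by end_near. Qed.

Hypothesis decay_le : forall x y : R, 0 < x -> x <= y -> y <= 1 -> decay x <= decay y.

Lemma iter_decay_in01 n y : 0 < y <= 1 -> 0 < iter n decay y <= 1.
Proof.
move=> y01; elim: n => //= n /[dup] IH /andP[_ h1].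
by rewrite decay_gt0//= (le_trans (ltW (decay_lt IH))).
Qed.

Lemma iter_decay_le n x y : 0 < x -> x <= y -> y <= 1 -> iter n decay x <= iter n decay y.
Proof.
move=> x0 xy y1.
have hx k : 0 < iter k decay x <= 1 by apply: iter_decay_in01; rewrite x0 (le_trans xy).
have hy k : 0 < iter k decay y <= 1 by apply: iter_decay_in01; rewrite y1 (lt_le_trans x0).
elim: n => //= n IH; apply: decay_le => //; first by case/andP: (hx n).
by case/andP: (hy n).
Qed.

Lemma iter_decay_Q n k : iter n decay (Q k) = Q (n + k).
Proof. by rewrite /Q iterD. Qed.

(** * Iterates started near [lam * Q (m n)] *)

Section Laplace.
Variables (m : nat -> nat) (y : nat -> R) (lam : R).
Hypothesis m_y : m n @[n --> \oo] --> \oo.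
Hypothesis m_small : (m n)%:R / n%:R @[n --> \oo] --> (0 : R).
Hypothesis y01 : forall n, 0 < y n <= 1.
Hypothesis lam_gt0 : 0 < lam.
Hypothesis y_cvg : y n / Q (m n) @[n --> \oo] --> lam.

Lemma near_m_gt0 : \forall n \near \oo, (0 < m n)%N.
Proof. by have /cvgnyPge/(_ 1%N) := m_y. Qed.

Lemma Q_sub_scale_cvg (t : R) : 0 < t ->
  (Q n - Q (n + Num.truncn (t * (m n)%:R))) / (Q n / (alpha * n%:R) * (m n)%:R)
  @[n --> \oo] --> t.
Proof.
move=> t0; have a0 := alpha_gt0.
pose k n := Num.truncn (t * (m n)%:R).
have km : (k n)%:R / (m n)%:R @[n --> \oo] --> t.
  exact: (cvg_comp _ (fun n => (Num.truncn (t * n%:R))%:R / n%:R) m_y (truncn_scale_cvg t0)).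
have ky : k n @[n --> \oo] --> \oo by exact: (cvg_comp _ _ m_y (truncn_scale_y t0)).
have k0 : \forall n \near \oo, (0 < k n)%N by have /cvgnyPge/(_ 1%N) := ky.
have ks : (k n)%:R / n%:R @[n --> \oo] --> (0 : R).
  have : (k n)%:R / (m n)%:R * ((m n)%:R / n%:R) @[n --> \oo] --> t * 0 by exact: cvgM.
  rewrite mulr0; apply: cvg_trans; apply: near_eq_cvg.
  near=> n.
  have n0 : 0 < n%:R :> R by rewrite ltr0n; near: n; exact: nbhs_infty_gt.
  have m0 : 0 < (m n)%:R :> R by rewrite ltr0n; near: n; exact: near_m_gt0.
  by field; rewrite !gt_eqF.
have : (Q n - Q (n + k n)) / (Q n / (alpha * n%:R) * (k n)%:R) * ((k n)%:R / (m n)%:R)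
   @[n --> \oo] --> 1 * t by apply: cvgM => //; exact: Q_sub_cvg.
rewrite mul1r; apply: cvg_trans; apply: near_eq_cvg; near=> n.
have n0 : 0 < n%:R :> R by rewrite ltr0n; near: n; exact: nbhs_infty_gt.
have m0 : 0 < (m n)%:R :> R by rewrite ltr0n; near: n; exact: near_m_gt0.
have kn0 : 0 < (k n)%:R :> R by rewrite ltr0n; near: n.
have q0 := Q_gt0 n.
by rewrite /= -/(k n); field; rewrite !gt_eqF.
Unshelve. all: by end_near. Qed.

Let w n := Q n / (alpha * n%:R) * (m n)%:R.

Let near_w_gt0 : \forall n \near \oo, 0 < w n.
Proof.
near=> n.
have n0 : 0 < n%:R :> R by rewrite ltr0n; near: n; exact: nbhs_infty_gt.
have m0 : 0 < (m n)%:R :> R by rewrite ltr0n; near: n; exact: near_m_gt0.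
by rewrite mulr_gt0// divr_gt0 ?Q_gt0// mulr_gt0.
Unshelve. all: by end_near. Qed.

(** For [t] above the critical value, [Q] at [t * m n] eventually lies below [y n]; since iterates
    are monotone, the orbit of [y n] after [n] steps stays above [Q] at [n + t * m n]. *)
Lemma laplace_le (t u : R) : lam `^ (- alpha) < t -> t < u ->
  \forall n \near \oo, (Q n - iter n decay (y n)) / w n <= u.
Proof.
move=> lt tu; have a0 := alpha_gt0.
have t0 : 0 < t by exact: le_lt_trans (powR_ge0 _ _) lt.
(* [b] is the asymptotic ratio of [Q] at [t * m] to [Q m]; the midpoint [c] below separates it from
   [lam], the limit of [y n / Q (m n)]. *)
pose b := t `^ (- alpha^-1).
have b0 : 0 < b by exact: powR_gt0.
have bE : b `^ alpha = t^-1.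
  by rewrite /b -powRrM mulNr mulVf ?gt_eqF// powRN powRr1// ltW.
have bl : b < lam.
  rewrite ltNge; apply/negP => lb.
  have : lam `^ alpha <= b `^ alpha by apply: ge0_ler_powR => //; rewrite ?nnegrE ltW.
  rewrite bE leNgt => /negP; apply.
  by rewrite -[ltRHS]invrK ltf_pV2 ?posrE ?invr_gt0 ?powR_gt0// -powRN.
pose c := (b + lam) / 2.
have c0 : 0 < c by have := lam_gt0; rewrite /c; lra.
have tc : 1 < t * c `^ alpha.
  rewrite mulrC -ltr_pdivrMr// mul1r -bE; apply: gt0_ltr_powR; rewrite ?nnegrE ?ltW//.
  by rewrite /c; lra.
have /(cvgr_gt _ y_cvg) Hy : c < lam by rewrite /c; lra.
have Hs := m_y (Q_scale_le t0 c0 tc).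
have Hc : \forall n \near \oo, (Q n - Q (n + Num.truncn (t * (m n)%:R))) / w n <= u :=
  cvgr_le _ (Q_sub_scale_cvg t0) _ tu.
near=> n.
have w0 : 0 < w n by near: n.
apply: (@le_trans _ _ ((Q n - Q (n + Num.truncn (t * (m n)%:R))) / w n)); last first.
  by near: n; exact: Hc.
rewrite ler_pM2r ?invr_gt0// lerB// -iter_decay_Q; apply: iter_decay_le.
- exact: Q_gt0.
- apply: (@le_trans _ _ (c * Q (m n))); first by near: n.
  by rewrite -ler_pdivlMr ?Q_gt0//; apply/ltW; near: n.
- by case/andP: (y01 n).
Unshelve. all: by end_near. Qed.

Lemma laplace_ge (t u : R) : 0 < t -> t < lam `^ (- alpha) -> u < t ->
  \forall n \near \oo, u <= (Q n - iter n decay (y n)) / w n.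
Proof.
move=> t0 tl ut; have a0 := alpha_gt0.
pose b := t `^ (- alpha^-1).
have b0 : 0 < b by exact: powR_gt0.
have bE : b `^ alpha = t^-1.
  by rewrite /b -powRrM mulNr mulVf ?gt_eqF// powRN powRr1// ltW.
have bl : lam < b.
  rewrite ltNge; apply/negP => lb.
  have : b `^ alpha <= lam `^ alpha by apply: ge0_ler_powR => //; rewrite ?nnegrE ltW.
  rewrite bE leNgt => /negP; apply.
  by rewrite -[ltLHS]invrK ltf_pV2 ?posrE ?invr_gt0 ?powR_gt0// -powRN.
pose c := (b + lam) / 2.
have c0 : 0 < c by have := lam_gt0; rewrite /c; lra.
have tc : t * c `^ alpha < 1.
  rewrite mulrC -ltr_pdivlMr// mul1r -bE; apply: gt0_ltr_powR; rewrite ?nnegrE ?ltW//.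
  by rewrite /c; lra.
have /(cvgr_lt _ y_cvg) Hy : lam < c by rewrite /c; lra.
have Hs := m_y (Q_scale_ge t0 c0 tc).
have Hc : \forall n \near \oo, u <= (Q n - Q (n + Num.truncn (t * (m n)%:R))) / w n :=
  cvgr_ge _ (Q_sub_scale_cvg t0) _ ut.
near=> n.
have w0 : 0 < w n by near: n.
apply: (@le_trans _ _ ((Q n - Q (n + Num.truncn (t * (m n)%:R))) / w n)).
  by near: n; exact: Hc.
rewrite ler_pM2r ?invr_gt0// lerB// -iter_decay_Q; apply: iter_decay_le.
- by case/andP: (y01 n).
- apply: (@le_trans _ _ (c * Q (m n))); last by near: n.
  by rewrite -ler_pdivrMr ?Q_gt0//; apply/ltW; near: n.
- exact: Q_le1.
Unshelve. all: by end_near. Qed.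

Lemma laplace_cvg :
  (Q n - iter n decay (y n)) / (Q n / (alpha * n%:R) * (m n)%:R)
  @[n --> \oo] --> lam `^ (- alpha).
Proof.
apply/cvgrPdist_le => eps eps0.
set L := lam `^ (- alpha); have L0 : 0 < L by exact: powR_gt0.
have h1 : \forall n \near \oo, (Q n - iter n decay (y n)) / w n <= L + eps.
  by apply: (@laplace_le (L + eps / 2)); rewrite -/L; lra.
have h2 : \forall n \near \oo, L - eps <= (Q n - iter n decay (y n)) / w n.
  (* The maximum with [L / 2] keeps [t] positive when [eps] is large. *)
  apply: (@laplace_ge (Num.max (L / 2) (L - eps / 2))).
  - by rewrite lt_max; apply/orP; left; lra.
  - by rewrite gt_max -/L; apply/andP; split; lra.
  - by rewrite lt_max; apply/orP; right; lra.
near=> n; rewrite ler_distlC; apply/andP; split; by near: n.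
Unshelve. all: by end_near. Qed.

End Laplace.

End Decay.

(** * Moments of the Gamma density *)

Section GammaMoments.
Context (R : realType).
Local Notation mu := (@lebesgue_measure R).
Local Notation I0 := (`]0, +oo[%classic : set (measurableTypeR R)).

Local Notation I0c := (`[0, +oo[%classic : set (measurableTypeR R)).

Lemma measurable_expR_mul (k : R) (D : set R) :
  measurable_fun D (fun x : R => expR (- (k * x))).
Proof.
apply: measurable_funTS; apply: continuous_measurable_fun => x.
apply: (@continuous_comp _ _ _ (fun x : R => - (k * x)) expR).
  by apply: continuousN; exact: mulrl_continuous.
exact: continuous_expR.
Qed.

Lemma integral_expR_mul (k : R) : 0 < k ->
  (\int[mu]_(x in I0) (expR (- (k * x)))%:E = (k^-1)%:E)%E.
Proof.
move=> k0.
have H : (\int[mu]_(x in I0) (k * expR (- (k * x)))%:E = 1%:E)%E.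
  rewrite -[RHS](integral_exponential_pdf k0) integral_itv_obnd_cbnd; last first.
    apply/measurable_EFinP; apply: measurable_funM => //.
    exact: measurable_expR_mul.
  rewrite [RHS](_ : _ = (\int[mu]_(x in I0c) (exponential_pdf k x)%:E)%E).
    apply: eq_integral => x; rewrite inE/= in_itv/= andbT => x0.
    by rewrite exponential_pdfE// mulNr.
  rewrite [in RHS]integral_mkcond; apply: eq_integral => x _ /=.
  rewrite restrict_EFin; congr EFin; rewrite [RHS]patchE.
  by case: ifPn => // /negbTE h; rewrite /exponential_pdf patchE h.
have e0 : forall x : R, I0 x -> (0 <= (expR (- (k * x)))%:E)%E.
  by move=> x _; rewrite lee_fin expR_ge0.
have -> : (\int[mu]_(x in I0) (expR (- (k * x)))%:E =
  (k^-1)%:E * (k%:E * \int[mu]_(x in I0) (expR (- (k * x)))%:E))%E.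
  by rewrite muleA -EFinM mulVf ?gt_eqF// mul1e.
rewrite -ge0_integralZl//=; last by rewrite lee_fin ltW.
  by under eq_integral do rewrite -EFinM; rewrite H mule1.
by apply/measurable_EFinP; exact: measurable_expR_mul.
Qed.

Lemma measurable_powR_expR (a k : R) (D : set R) :
  measurable_fun D (fun x : R => x `^ a * expR (- (k * x))).
Proof.
apply: measurable_funM; last exact: measurable_expR_mul.
apply: measurable_funTS; exact: measurable_powR.
Qed.

(** Half of the decay of [expR (- x)] is spent on the power, the other half is kept for
    integrability; [1 + x] is a majorant on both sides of [x = 1]. *)
Lemma powR_le_expR (a x : R) : 0 <= a <= 1 -> 0 < x -> x `^ a <= 2 * expR (x / 2).
Proof.
move=> /andP[a0 a1] x0; apply: (@le_trans _ _ (1 + x)); last first.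
  by have := expR_ge1Dx (x / 2); lra.
have [x1|/ltW x1] := leP 1 x.
  by apply: (le_trans (ler1_powR x1 a1)); rewrite lerDr.
apply: (@le_trans _ _ 1); last by rewrite lerDl ltW.
have -> : 1 = 1 `^ a :> R by rewrite powR1.
by apply: ge0_ler_powR => //; rewrite nnegrE ltW.
Qed.

Lemma integrable_expR_mul (k : R) : 0 < k ->
  mu.-integrable I0 (EFin \o (fun x => expR (- (k * x)))).
Proof.
move=> k0; apply/integrableP; split.
  by apply/measurable_EFinP; exact: measurable_expR_mul.
under eq_integral do rewrite /= ger0_norm ?expR_ge0//.
by rewrite integral_expR_mul// ltry.
Qed.

Lemma integrable_powR_expR (a k : R) : 0 <= a <= 1 -> 1 <= k ->
  mu.-integrable I0 (EFin \o (fun x => x `^ a * expR (- (k * x)))).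
Proof.
move=> a01 k1.
have h0 : 0 < 2^-1 :> R by rewrite invr_gt0.
have := integrableZl (measurable_itv _ : measurable I0) 2 (integrable_expR_mul h0).
apply: le_integrable => //; first by apply/measurable_EFinP; exact: measurable_powR_expR.
move=> x /=; rewrite in_itv/= andbT => x0.
rewrite lee_fin !ger0_norm ?mulr_ge0 ?powR_ge0 ?expR_ge0//.
apply: (@le_trans _ _ (2 * expR (x / 2) * expR (- x))).
  apply: ler_pM; rewrite ?powR_ge0 ?expR_ge0//; first exact: powR_le_expR.
  by rewrite ler_expR lerN2 ler_peMl// ltW.
rewrite -mulrA -expRD ler_pM2l// ler_expR; lra.
Qed.

(** Substitution of [k * x] for [x], on the closed half-line, where [0 < a] provides continuity of
    the integrand at 0. *)
Lemma integral_powR_expR_scale (a k : R) : 0 < a -> 0 < k ->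
  (\int[mu]_(x in I0) (x `^ a * expR (- x))%:E =
   (k `^ (1 + a))%:E * \int[mu]_(x in I0) (x `^ a * expR (- (k * x)))%:E)%E.
Proof.
move=> a0 k0.
have mG : measurable_fun I0 (fun x : R => x `^ a * expR (- x)).
  have := @measurable_powR_expR a 1 I0; apply: eq_measurable_fun => x _.
  by rewrite mul1r.
have dF x : derivable (fun x : R => k * x) x 1 by exact: derivableM.
have F'E : derive1 (fun x : R => k * x) = cst k.
  apply/funext => x; rewrite derive1E deriveM// derive_id derive_cst scaler0 addr0.
  by rewrite -[RHS]mulr1.
rewrite integral_itv_obnd_cbnd; last exact/measurable_EFinP.
have F0 : k * 0 = 0 :> R by rewrite mulr0.
have := @increasing_ge0_integration_by_substitutiony R (fun x : R => k * x)
  (fun x => x `^ a * expR (- x)) 0; rewrite F0 => ->//.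
- rewrite F'E integral_itv_obnd_cbnd; last first.
    apply/measurable_EFinP; exact: measurable_powR_expR.
  rewrite -ge0_integralZl//=; last 3 first.
  - by apply/measurable_EFinP; exact: measurable_powR_expR.
  - by move=> x _; rewrite lee_fin mulr_ge0 ?powR_ge0 ?expR_ge0.
  - by rewrite lee_fin powR_ge0.
  - apply: eq_integral => x; rewrite inE/= in_itv/= andbT => x0.
    rewrite -EFinM; congr EFin; rewrite fctE/= powRM ?(ltW k0)//.
    rewrite powRD ?(gt_eqF k0)//; last by rewrite implybT.
    rewrite powRr1 ?(ltW k0)//; ring.
- by move=> x y _ _ xy; rewrite ltr_pM2l.
- by rewrite F'E => x _; exact: cst_continuous.
- by rewrite F'E; apply/cvg_ex; exists k; exact: cvg_cst.
- by rewrite F'E; apply/cvg_ex; exists k; exact: cvg_cst.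
- split; first by move=> x _; exact: dF.
  by apply: cvg_at_right_filter; apply: cvgMr; exact: cvg_id.
- exact: gt0_cvgMry.
- apply/continuous_within_itvcyP; split.
    move=> x; rewrite in_itv/= andbT => x0.
    apply: cvgM; last first.
      by apply: continuous_comp; [exact: continuousN|exact: continuous_expR].
    have : {for x, continuous (fun y : R => y `^ a)}.
      apply: differentiable_continuous; apply/derivable1_diffP.
      by apply: derivable_powR; rewrite in_itv/= andbT.
    exact.
  apply: cvgM; first by rewrite powR0 ?gt_eqF//; exact: powR_cvg0.
  apply: cvg_at_right_filter.
  by apply: continuous_comp; [exact: continuousN|exact: continuous_expR].
- by move=> x _; rewrite mulr_ge0 ?powR_ge0 ?expR_ge0.
Qed.

Variable a : R.
Hypothesis a01 : 0 < a < 1.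

Lemma GammaDE : Gamma (1 + a) = \int[mu]_(x in I0) (x `^ a * expR (- x)).
Proof. by rewrite /Gamma addrAC subrr add0r. Qed.

Lemma Rintegral_expR (i : nat) :
  \int[mu]_(x in I0) (expR (- x) ^+ i.+1) = i.+1%:R^-1.
Proof.
rewrite /Rintegral; under eq_integral do rewrite -expRM_natl mulrN.
by rewrite integral_expR_mul.
Qed.

Lemma integrable_expRX (i : nat) :
  mu.-integrable I0 (EFin \o (fun x => expR (- x) ^+ i.+1)).
Proof.
have := @integrable_expR_mul i.+1%:R (ltr0Sn _ _).
by apply: eq_integrable => // x _ /=; rewrite -expRM_natl mulrN.
Qed.

Lemma integrable_powR_expRX (i : nat) :
  mu.-integrable I0 (EFin \o (fun x => x `^ a * expR (- x) ^+ i.+1)).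
Proof.
have a01' : 0 <= a <= 1 by case/andP: a01 => /ltW -> /ltW ->.
have := @integrable_powR_expR a i.+1%:R a01'; rewrite ler1n => /(_ isT).
by apply: eq_integrable => // x _ /=; rewrite -expRM_natl mulrN.
Qed.

Lemma Rintegral_powR_expR (i : nat) :
  \int[mu]_(x in I0) (x `^ a * expR (- x) ^+ i.+1) =
  Gamma (1 + a) * i.+1%:R `^ (- (1 + a)).
Proof.
have k0 : 0 < i.+1%:R :> R by [].
have a0 : 0 < a by case/andP: a01.
rewrite GammaDE /Rintegral (integral_powR_expR_scale a0 k0).
have -> : (\int[mu]_(x in I0) (x `^ a * expR (- (i.+1%:R * x)))%:E =
  \int[mu]_(x in I0) (x `^ a * expR (- x) ^+ i.+1)%:E)%E.
  by apply: eq_integral => x _; rewrite -expRM_natl mulrN.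
rewrite fineM//=; last first.
  exact: (integrable_fin_num (measurable_itv _ : measurable I0) (integrable_powR_expRX i)).
rewrite mulrAC -powRD; last by rewrite (gt_eqF k0) implybT.
by rewrite subrr powRr0 mul1r.
Qed.

(** The last factor is the Jacobian of [y = expR (- x)]: for [w = 1] the integral is that of [q]
    over the unit interval. It also makes every exponent [i.+1] positive, which gives
    integrability. *)
Definition weighted (w : R -> R) (q : {poly R}) (x : R) : R :=
  w x * (q.[expR (- x)] * expR (- x)).

Lemma weightedE w q x :
  weighted w q x = \sum_(i < size q) q`_i * (w x * expR (- x) ^+ i.+1).
Proof.
rewrite /weighted horner_coef mulr_suml mulr_sumr; apply: eq_bigr => i _.
by rewrite exprSr; ring.
Qed.

Lemma integrable_weighted w (q : {poly R}) :
  (forall i, mu.-integrable I0 (EFin \o (fun x => w x * expR (- x) ^+ i.+1))) ->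
  mu.-integrable I0 (EFin \o weighted w q).
Proof.
move=> h; have mI : measurable I0 := measurable_itv _.
have := @integrable_sum _ _ _ mu _ mI _ (index_enum 'I_(size q)) xpredT
  (fun i x => (q`_i)%:E * (w x * expR (- x) ^+ i.+1)%:E)%E
  (fun i _ => integrableZl mI (q`_i) (h i)).
by apply: eq_integrable => // x _ /=; rewrite weightedE -sumEFin.
Qed.

Lemma Rintegral_weighted w (q : {poly R}) :
  (forall i, mu.-integrable I0 (EFin \o (fun x => w x * expR (- x) ^+ i.+1))) ->
  \int[mu]_(x in I0) weighted w q x =
  \sum_(i < size q) q`_i * \int[mu]_(x in I0) (w x * expR (- x) ^+ i.+1).
Proof.
move=> h; have mI : measurable I0 := measurable_itv _.
rewrite {1}/Rintegral.
have -> : (\int[mu]_(x in I0) (weighted w q x)%:E = \int[mu]_(x in I0)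
  \sum_(i < size q) ((q`_i)%:E * (w x * expR (- x) ^+ i.+1)%:E))%E.
  by apply: eq_integral => x _; rewrite weightedE -sumEFin.
rewrite integral_sum//; last by move=> i; exact: (integrableZl mI (q`_i) (h i)).
rewrite -sum_fine; last first.
  move=> i _; rewrite integralZl//; last exact: h.
  by rewrite fin_numM// (integrable_fin_num mI (h i)).
apply: eq_bigr => i _; rewrite integralZl//; last exact: h.
by rewrite fineM// (integrable_fin_num mI (h i)).
Qed.

(* The two moment functionals of a polynomial [q], i.e. the integrals of
   [q (exp (- x)) * exp (- x)] against [1] and [x `^ a / Gamma (1 + a)]. *)
Definition mom0 (q : {poly R}) : R := \sum_(i < size q) q`_i * i.+1%:R^-1.
Definition moma (q : {poly R}) : R := \sum_(i < size q) q`_i * i.+1%:R `^ (- (1 + a)).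

Lemma integrable_weighted1 q : mu.-integrable I0 (EFin \o weighted (fun=> 1) q).
Proof.
apply: integrable_weighted => i; have := integrable_expRX i.
by apply: eq_integrable => // x _ /=; rewrite mul1r.
Qed.

Lemma integrable_weighteda q : mu.-integrable I0 (EFin \o weighted (fun x => x `^ a) q).
Proof. exact/integrable_weighted/integrable_powR_expRX. Qed.

Lemma Rintegral_weighted1 q : \int[mu]_(x in I0) weighted (fun=> 1) q x = mom0 q.
Proof.
rewrite Rintegral_weighted => [|i]; last first.
  have := integrable_expRX i.
  by apply: eq_integrable => // x _ /=; rewrite mul1r.
apply: eq_bigr => i _; rewrite -Rintegral_expR; congr (_ * _).
by apply: eq_Rintegral => x _; rewrite mul1r.
Qed.

Lemma Rintegral_weighteda q :
  \int[mu]_(x in I0) weighted (fun x => x `^ a) q x = Gamma (1 + a) * moma q.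
Proof.
rewrite Rintegral_weighted; last exact: integrable_powR_expRX.
rewrite /moma mulr_sumr; apply: eq_bigr => i _.
by rewrite Rintegral_powR_expR; ring.
Qed.

Lemma mom0C c : mom0 c%:P = c.
Proof.
rewrite /mom0 size_polyC; case: eqVneq => [->|c0]; first by rewrite big_ord0.
by rewrite big_ord1 coefC/= invr1 mulr1.
Qed.

Lemma momaC c : moma c%:P = c.
Proof.
rewrite /moma size_polyC; case: eqVneq => [->|c0]; first by rewrite big_ord0.
by rewrite big_ord1 coefC/= powR1 mulr1.
Qed.

(** The power with exponent [a] dominates [1 - expR (- x)]; integrating against [expR (- x)] gives
    the lower bound 1/2, computed as [mom0 (1 - 'X)]. *)
Lemma Gamma_gt0 : 0 < Gamma (1 + a).
Proof.
have [a0 a1] := andP a01.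
apply: (@lt_le_trans _ _ (2^-1)); first by rewrite invr_gt0.
have -> : Gamma (1 + a) = Gamma (1 + a) * moma 1%:P by rewrite momaC mulr1.
have -> : 2^-1 = mom0 (1 - 'X).
  have s2 : size (1 - 'X : {poly R}) = 2%N.
    by rewrite -size_polyN opprB size_XsubC.
  rewrite /mom0 s2 big_ord_recl big_ord1 !coefB !coef1 !coefX/=.
  have -> : (bump 0 0).+1 = 2%N by []; lra.
rewrite -Rintegral_weighted1 -Rintegral_weighteda; apply: le_Rintegral.
- exact: measurable_itv.
- exact: integrable_weighted1.
- exact: integrable_weighteda.
move=> x; rewrite /= in_itv/= andbT => x0.
rewrite /weighted hornerC hornerD hornerN hornerX hornerC !mul1r ler_pM2r ?expR_gt0//.
have [x1|/ltW x1] := leP 1 x.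
  apply: (@le_trans _ _ 1); first by rewrite gerBl expR_ge0.
  by have := ler_powR x1 (ltW a0); rewrite powRr0.
apply: (@le_trans _ _ x); first by have := expR_ge1Dx (- x); lra.
by apply: ger1_powR; rewrite ?x0// ltW.
Qed.

(** The error term carries the power of [x] because it has to absorb the tail, where that power is
    unbounded and only [K <= delta] is known. *)
Lemma moma_le (K : {poly R}) (A delta : R) :
  (forall x, 0 < x -> K.[expR (- x)] * x `^ a <= A * K.[expR (- x)] + delta * x `^ a) ->
  Gamma (1 + a) * moma K <= A * mom0 K + delta * Gamma (1 + a).
Proof.
move=> h; have mI : measurable I0 := measurable_itv _.
have i1 := integrable_weighted1 K; have ia := integrable_weighteda 1%:P.
have E : A * mom0 K + delta * Gamma (1 + a) =
    \int[mu]_(x in I0) (A * weighted (fun=> 1) K x + delta * weighted (fun x => x `^ a) 1%:P x).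
  rewrite RintegralD//; [|exact: (integrableZl mI A i1)|exact: (integrableZl mI delta ia)].
  rewrite (RintegralZl A mI i1) (RintegralZl delta mI ia).
  by rewrite Rintegral_weighted1 Rintegral_weighteda momaC mulr1.
rewrite E -Rintegral_weighteda; apply: le_Rintegral => //.
- exact: integrable_weighteda.
- exact: (integrableD mI (integrableZl mI A i1) (integrableZl mI delta ia)).
move=> x; rewrite /= in_itv/= andbT => x0; rewrite /weighted hornerC !mul1r.
have := h x x0; rewrite -(ler_pM2r (expR_gt0 (- x))); lra.
Qed.

(** For [B > 0], subtracting [delta] makes the left side nonpositive wherever [K <= delta], so the
    power of [x] has to reach [B] only near the peak of the kernel. *)
Lemma moma_ge (K : {poly R}) (B delta : R) :
  (forall x, 0 < x -> B * (K.[expR (- x)] - delta) <= K.[expR (- x)] * x `^ a) ->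
  B * (mom0 K - delta) <= Gamma (1 + a) * moma K.
Proof.
move=> h; have mI : measurable I0 := measurable_itv _.
have i1 := integrable_weighted1 K; have i0 := integrable_weighted1 delta%:P.
have E : B * (mom0 K - delta) =
    \int[mu]_(x in I0) (B * weighted (fun=> 1) K x - B * weighted (fun=> 1) delta%:P x).
  rewrite RintegralB//; [|exact: (integrableZl mI B i1)|exact: (integrableZl mI B i0)].
  rewrite (RintegralZl B mI i1) (RintegralZl B mI i0).
  by rewrite !Rintegral_weighted1 mom0C mulrBr.
rewrite E -Rintegral_weighteda; apply: le_Rintegral => //.
- exact: (integrableB mI (integrableZl mI B i1) (integrableZl mI B i0)).
- exact: integrable_weighteda.
move=> x; rewrite /= in_itv/= andbT => x0; rewrite /weighted hornerC !mul1r.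
have := h x x0; rewrite -(ler_pM2r (expR_gt0 (- x))); lra.
Qed.

End GammaMoments.

(** * Polynomial approximation of an indicator *)

Section Approximants.
Context (R : realType).

(** Common form of [mom0], [moma] and evaluation of [prim], so that linearity is proved once. *)
Definition mom (c : nat -> R) (q : {poly R}) : R := \sum_(i < size q) q`_i * c i.

Lemma mom_wide c n (q : {poly R}) : (size q <= n)%N -> mom c q = \sum_(i < n) q`_i * c i.
Proof.
move=> qn; rewrite /mom (big_ord_widen n (fun i => q`_i * c i))// big_mkcond/=.
by apply: eq_bigr => i _; case: ltnP => // /(nth_default 0) ->; rewrite mul0r.
Qed.

Lemma mom_linear c (b : R) (p q : {poly R}) : mom c (b *: p + q) = b * mom c p + mom c q.
Proof.
set n := maxn (maxn (size p) (size q)) (size (b *: p + q)).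
rewrite !(@mom_wide _ n) ?/n ?leq_max ?leqnn ?orbT//.
rewrite mulr_sumr -big_split/=; apply: eq_bigr => i _.
by rewrite coefD coefZ mulrDl mulrA.
Qed.

Lemma mom_scale c (b : R) (p : {poly R}) : mom c (b *: p) = b * mom c p.
Proof. by rewrite -[b *: p]addr0 mom_linear [mom c 0]/mom size_poly0 big_ord0 addr0. Qed.

(** The primitive vanishing at 0: at [expR (- x)] it involves only the exponentials
    [expR (- (i.+1 * x))], with no constant term. *)
Definition prim (p : {poly R}) : {poly R} :=
  \sum_(i < size p) (p`_i / i.+1%:R) *: 'X^(i.+1).

Lemma horner_prim p y : (prim p).[y] = mom (fun i => y ^+ i.+1 / i.+1%:R) p.
Proof.
rewrite /prim horner_sum; apply: eq_bigr => i _.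
by rewrite hornerZ hornerXn; ring.
Qed.

Lemma prim_scale b p y : (prim (b *: p)).[y] = b * (prim p).[y].
Proof. by rewrite !horner_prim mom_scale. Qed.

Lemma prim0 p : (prim p).[0] = 0.
Proof.
rewrite horner_prim /mom big1// => i _.
by rewrite expr0n/= mul0r mulr0.
Qed.

Lemma prim1 p : (prim p).[1] = mom0 p.
Proof.
by rewrite horner_prim; apply: eq_bigr => i _; rewrite expr1n div1r.
Qed.

Lemma deriv_prim p : (prim p)^`() = p.
Proof.
rewrite /prim raddf_sum -[RHS]coefK poly_def; apply: eq_bigr => i _.
by rewrite /= derivZ derivXn/= -scalerMnr scalerMnl -mulr_natr mulfVK// pnatr_eq0.
Qed.

Lemma prim_mvt p u v : u <= v ->
  exists2 z, u <= z <= v & (prim p).[v] - (prim p).[u] = p.[z] * (v - u).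
Proof.
move=> uv.
have [z] := @MVT_segment R (horner (prim p)) (horner p) u v uv
  (fun x _ => eq_ind _ (fun q : {poly R} => is_derive x (1 : R) (horner (prim p)) q.[x])
     (is_derive_poly (prim p) x) _ (deriv_prim p))
  (continuous_subspaceT (@continuous_horner R (prim p))).
by rewrite in_itv/= => uzv E; exists z.
Qed.

Lemma prim_sub_ge p (u v c : R) : u <= v -> (forall z, u <= z <= v -> c <= p.[z]) ->
  c * (v - u) <= (prim p).[v] - (prim p).[u].
Proof.
by move=> uv h; have [z zuv ->] := prim_mvt p uv; rewrite ler_wpM2r ?subr_ge0// h.
Qed.

Lemma prim_sub_le p (u v c : R) : u <= v -> (forall z, u <= z <= v -> p.[z] <= c) ->
  (prim p).[v] - (prim p).[u] <= c * (v - u).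
Proof.
by move=> uv h; have [z zuv ->] := prim_mvt p uv; rewrite ler_wpM2r ?subr_ge0// h.
Qed.

(* Normalized powers of [1 - (y - y0) ^+ 2] concentrate at [y0]. *)
Lemma landau_kernel (y0 eta delta : R) :
  0 < eta -> 0 <= y0 - 2 * eta -> y0 + 2 * eta <= 1 -> 0 < delta ->
  exists K : {poly R}, [/\ forall y, 0 <= y <= 1 -> 0 <= K.[y], mom0 K = 1 &
    forall y, 0 <= y <= 1 -> 2 * eta <= `|y - y0| -> K.[y] <= delta].
Proof.
move=> e0 y0l y0u d0.
(* Values of [1 - (y - y0) ^+ 2] at distances [eta] and [2 * eta]. The [N]-th power has mass at
   least [q1 ^+ N * (2 * eta)] and is at most [q2 ^+ N] beyond [2 * eta]; [N] makes the quotient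
   smaller than [delta]. *)
set q1 := 1 - eta ^+ 2; set q2 := 1 - (2 * eta) ^+ 2.
have q1_gt0 : 0 < q1 by rewrite /q1; nra.
have q2_ge0 : 0 <= q2 by rewrite /q2; nra.
have q21 : q2 < q1 by rewrite /q1 /q2; nra.
have [N HN] : exists N, (q2 / q1) ^+ N < delta * (2 * eta).
  have cv : (q2 / q1) ^+ n @[n --> \oo] --> (0 : R).
    by apply: cvg_expr; rewrite ger0_norm ?divr_ge0 ?(ltW q1_gt0)// ltr_pdivrMr// mul1r.
  have d2 : 0 < delta * (2 * eta) by rewrite !mulr_gt0.
  have [N _ HN] := cvgr_lt _ cv _ d2.
  by exists N; exact: (HN N (leqnn N)).
set K0 : {poly R} := (1 - ('X - y0%:P) ^+ 2) ^+ N.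
have K0E y : K0.[y] = (1 - (y - y0) ^+ 2) ^+ N.
  by rewrite horner_exp !(hornerD, hornerN, horner_exp, hornerX, hornerC).
have sq_le (y t : R) : 0 <= t -> `|y - y0| <= t -> (y - y0) ^+ 2 <= t ^+ 2.
  by move=> t0 h; rewrite -[_ ^+ 2](real_normK (num_real _)) lerXn2r ?nnegrE.
have base_ge0 y : 0 <= y <= 1 -> 0 <= 1 - (y - y0) ^+ 2.
  move=> /andP[? ?]; rewrite subr_ge0 -[leRHS](expr1n _ 2); apply: sq_le => //.
  by rewrite ler_norml; apply/andP; split; lra.
have K0_ge0 y : 0 <= y <= 1 -> 0 <= K0.[y].
  by move=> y01; rewrite K0E exprn_ge0// base_ge0.
set C := mom0 K0.
have C_ge : q1 ^+ N * (2 * eta) <= C.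
  rewrite /C -prim1.
  have h1 : 0 * (y0 - eta - 0) <= (prim K0).[y0 - eta] - (prim K0).[0].
    apply: prim_sub_ge; first lra.
    by move=> z /andP[? ?]; apply: K0_ge0; apply/andP; split; lra.
  have h2 : 0 * (1 - (y0 + eta)) <= (prim K0).[1] - (prim K0).[y0 + eta].
    apply: prim_sub_ge; first lra.
    by move=> z /andP[? ?]; apply: K0_ge0; apply/andP; split; lra.
  have h3 : q1 ^+ N * (y0 + eta - (y0 - eta)) <= (prim K0).[y0 + eta] - (prim K0).[y0 - eta].
    apply: prim_sub_ge; first lra.
    move=> z /andP[? ?]; rewrite K0E lerXn2r ?nnegrE ?(ltW q1_gt0)//.
      by apply: base_ge0; apply/andP; split; lra.
    by rewrite lerB// sq_le ?(ltW e0)// ler_norml; apply/andP; split; lra.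
  move: h1 h2 h3; rewrite !mul0r prim0.
  have -> : y0 + eta - (y0 - eta) = 2 * eta by ring.
  lra.
have C_gt0 : 0 < C by apply: lt_le_trans C_ge; rewrite !mulr_gt0// exprn_gt0.
exists (C^-1 *: K0); split.
- by move=> y y01; rewrite hornerZ mulr_ge0 ?invr_ge0 ?(ltW C_gt0)// K0_ge0.
- have -> : mom0 (C^-1 *: K0) = C^-1 * mom0 K0
    by exact: (mom_scale (fun i : nat => i.+1%:R^-1)).
  by rewrite mulVf// gt_eqF.
move=> y y01 hy; rewrite hornerZ mulrC ler_pdivrMr// K0E.
apply: (@le_trans _ _ (q2 ^+ N)).
  rewrite lerXn2r ?nnegrE ?base_ge0// lerB//.
  by rewrite -[leRHS](real_normK (num_real _)) lerXn2r ?nnegrE// mulr_ge0// ltW.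
apply: (@le_trans _ _ (delta * (q1 ^+ N * (2 * eta)))); last by rewrite ler_pM2l.
have := ltW HN; rewrite expr_div_n ler_pdivrMr ?exprn_gt0//; lra.
Qed.

Variable a : R.
Hypothesis a01 : 0 < a < 1.

Let a_gt0 : 0 < a. Proof. by case/andP: a01. Qed.
Let a_lt1 : a < 1. Proof. by case/andP: a01. Qed.

(** The kernel sits just below [expR (- 1)], so its primitive has reached [1 - delta] there;
    dividing by [1 - delta] lifts it above the indicator. Outside [x <= 1 + tau] the kernel is at
    most [delta]. *)
Lemma upper_approx eps : 0 < eps -> exists K : {poly R},
  [/\ forall y, 0 <= y <= 1 -> 0 <= (prim K).[y],
      forall y, expR (- 1) <= y <= 1 -> 1 <= (prim K).[y] &
      moma a K <= (Gamma (1 + a))^-1 + eps].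
Proof.
move=> eps0; have G0 := Gamma_gt0 a01.
set G := Gamma (1 + a) in G0 *; set g := G^-1.
have g0 : 0 < g by rewrite invr_gt0.
have gG : g * G = 1 by rewrite mulVf// gt_eqF.
(* The final requirement [(1 + tau) * g + delta <= (g + eps) * (1 - delta)] reads
   [tau * g + delta * (1 + g + eps) <= eps]; each summand gets [eps / 2]. *)
set tau := eps / (2 * g); set delta := eps / (2 * (1 + g + eps)).
have tau0 : 0 < tau by rewrite divr_gt0// mulr_gt0.
have den : 0 < 2 * (1 + g + eps) by rewrite mulr_gt0//; lra.
have delta0 : 0 < delta by rewrite divr_gt0.
have delta1 : delta < 1 by rewrite ltr_pdivrMr//; lra.
have tauE : tau * g = eps / 2 by rewrite /tau; field; rewrite gt_eqF.
have deltaE : delta * (1 + g + eps) = eps / 2.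
  by rewrite /delta; field; rewrite gt_eqF//; lra.
set s := 1 + tau.
have s1 : 1 < s by rewrite ltrDl.
set y1 := expR (- s); set e1 : R := expR (- 1).
have y1_gt0 : 0 < y1 by exact: expR_gt0.
have y1e : y1 < e1 by rewrite ltr_expR ltrN2.
have e11 : e1 < 1 by rewrite expR_lt1 oppr_lt0.
(* Chosen so that [y0 - 2 * eta = y1] and [y0 + 2 * eta = e1]. *)
set y0 := (y1 + e1) / 2; set eta := (e1 - y1) / 4.
have [| | | |K [K0 K1 Kd]] := @landau_kernel y0 eta delta;
  rewrite /y0 /eta; [lra|lra|lra|by []|].
have H1 : (prim K).[1] = 1 by rewrite prim1.
have H_ge0 y : 0 <= y <= 1 -> 0 <= (prim K).[y].
  move=> /andP[y0' y1']; have := @prim_sub_ge K 0 y 0 y0'.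
  rewrite mul0r prim0 subr0; apply => z /andP[? ?]; apply: K0; apply/andP; split; lra.
have H_ge y : e1 <= y <= 1 -> 1 - delta <= (prim K).[y].
  move=> /andP[ye y1']; have := @prim_sub_le K y 1 delta y1'; rewrite H1 => h.
  have {h} : 1 - (prim K).[y] <= delta * (1 - y).
    apply: h => z /andP[? ?]; apply: Kd; first by apply/andP; split; lra.
    rewrite ler_normr; apply/orP; left; rewrite /y0 /eta; lra.
  nra.
have up : Gamma (1 + a) * moma a K <= s * mom0 K + delta * Gamma (1 + a).
  apply: (moma_le a01) => x x0.
  have Ky0 : 0 <= K.[expR (- x)].
    by apply: K0; rewrite expR_ge0 expR_le1 oppr_le0 ltW.
  have [xs|sx] := leP x s.
    apply: (@le_trans _ _ (s * K.[expR (- x)])).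
      rewrite mulrC ler_wpM2r//; apply: (@le_trans _ _ (s `^ a)).
        by apply: ge0_ler_powR; rewrite ?nnegrE ?(ltW a_gt0) ?(ltW x0)//; lra.
      by apply: ler1_powR; exact: ltW.
    by rewrite lerDl mulr_ge0 ?powR_ge0// ltW.
  apply: (@le_trans _ _ (delta * x `^ a)).
    rewrite ler_wpM2r ?powR_ge0//; apply: Kd.
      by rewrite expR_ge0 expR_le1 oppr_le0 ltW.
    have : expR (- x) < y1 by rewrite ltr_expR ltrN2.
    by rewrite ler_normr => ?; apply/orP; right; rewrite /y0 /eta; lra.
  by rewrite lerDr mulr_ge0//; lra.
exists ((1 - delta)^-1 *: K); split.
- by move=> y y01; rewrite prim_scale mulr_ge0 ?H_ge0// invr_ge0 subr_ge0 ltW.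
- by move=> y /H_ge h; rewrite prim_scale mulrC ler_pdivlMr ?mul1r ?subr_gt0.
have -> : moma a ((1 - delta)^-1 *: K) = (1 - delta)^-1 * moma a K
  by exact: (mom_scale (fun i : nat => i.+1%:R `^ (- (1 + a)))).
rewrite mulrC ler_pdivrMr ?subr_gt0//.
have {up} : moma a K <= s * g + delta.
  by rewrite -(ler_pM2l G0) mulrDr mulrCA [G * g]mulrC gG; move: up; rewrite K1 -/G; lra.
rewrite /s -/g; lra.
Qed.

(** The kernel now sits just above [expR (- 1)], and up to that point its primitive is at most
    [delta * y]. Subtracting the constant [delta] from the kernel removes exactly this amount. *)
Lemma lower_approx eps : 0 < eps -> exists K : {poly R},
  [/\ forall y, 0 <= y <= 1 -> (prim K).[y] <= 1,
      forall y, 0 <= y <= expR (- 1) -> (prim K).[y] <= 0 &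
      (Gamma (1 + a))^-1 - eps <= moma a K].
Proof.
move=> eps0; have G0 := Gamma_gt0 a01.
set G := Gamma (1 + a) in G0 *; set g := G^-1.
have g0 : 0 < g by rewrite invr_gt0.
have gG : g * G = 1 by rewrite mulVf// gt_eqF.
(* The minimum with 1/2 keeps [s = 1 - tau] positive. *)
set tau := Num.min (2^-1) (eps / (2 * g)); set delta := eps / (2 * (1 + g + eps)).
have tau0 : 0 < tau by rewrite lt_min invr_gt0 ltr0n/= divr_gt0// mulr_gt0.
have tau1 : tau <= 2^-1 by rewrite ge_min lexx.
have den : 0 < 2 * (1 + g + eps) by rewrite mulr_gt0//; lra.
have delta0 : 0 < delta by rewrite divr_gt0.
have delta1 : delta < 1 by rewrite ltr_pdivrMr//; lra.
have tauE : tau * g <= eps / 2.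
  have : tau <= eps / (2 * g) by rewrite ge_min lexx orbT.
  rewrite ler_pdivlMr ?mulr_gt0//; lra.
have deltaE : delta * (1 + g + eps) = eps / 2.
  by rewrite /delta; field; rewrite gt_eqF//; lra.
set s := 1 - tau.
have s0 : 0 < s by rewrite /s; lra.
have s1 : s < 1 by rewrite /s; lra.
set y2 := expR (- s); set e1 : R := expR (- 1).
have e1_gt0 : 0 < e1 by exact: expR_gt0.
have y2e : e1 < y2 by rewrite ltr_expR ltrN2.
have y21 : y2 < 1 by rewrite expR_lt1 oppr_lt0.
set y0 := (y2 + e1) / 2; set eta := (y2 - e1) / 4.
have [| | | |K [K0 K1 Kd]] := @landau_kernel y0 eta delta;
  rewrite /y0 /eta; [lra|lra|lra|by []|].
have H1 : (prim K).[1] = 1 by rewrite prim1.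
have H_le1 y : 0 <= y <= 1 -> (prim K).[y] <= 1.
  move=> /andP[y0' y1']; have := @prim_sub_ge K y 1 0 y1'.
  rewrite mul0r H1 subr_ge0; apply => z /andP[? ?]; apply: K0; apply/andP; split; lra.
have H_le y : 0 <= y <= e1 -> (prim K).[y] <= delta * y.
  move=> /andP[y0' ye]; have := @prim_sub_le K 0 y delta y0'.
  rewrite prim0 !subr0; apply => z /andP[? ?].
  apply: Kd; first by apply/andP; split; lra.
  rewrite ler_normr; apply/orP; right; rewrite /y0 /eta; lra.
have lo : s * (mom0 K - delta) <= Gamma (1 + a) * moma a K.
  apply: (moma_ge a01) => x x0.
  have Ky0 : 0 <= K.[expR (- x)].
    by apply: K0; rewrite expR_ge0 expR_le1 oppr_le0 ltW.
  have [sx|xs] := leP s x.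
    apply: (@le_trans _ _ (s * K.[expR (- x)])).
      by rewrite ler_pM2l// lerBlDr lerDl ltW.
    rewrite mulrC ler_wpM2l//; apply: (@le_trans _ _ (s `^ a)).
      by apply: ger1_powR; rewrite ?s0 ltW.
    by apply: ge0_ler_powR; rewrite ?nnegrE ?(ltW a_gt0) ?(ltW x0) ?(ltW s0).
  apply: (@le_trans _ _ 0); last by rewrite mulr_ge0 ?powR_ge0.
  rewrite pmulr_rle0// subr_le0; apply: Kd.
    by rewrite expR_ge0 expR_le1 oppr_le0 ltW.
  have : y2 < expR (- x) by rewrite ltr_expR ltrN2.
  by rewrite ler_normr => ?; apply/orP; left; rewrite /y0 /eta; lra.
have primC y : (prim (1 *: K + (- delta)%:P)).[y] = (prim K).[y] - delta * y.
  rewrite !horner_prim mom_linear mul1r; congr (_ + _).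
  by rewrite /mom size_polyC oppr_eq0 gt_eqF//= big_ord1 coefC/= expr1 divr1 mulNr.
exists (1 *: K + (- delta)%:P); split.
- move=> y y01; rewrite primC; have := H_le1 y y01; have [? ?] := andP y01.
  have : 0 <= delta * y by rewrite mulr_ge0// ltW.
  lra.
- by move=> y /H_le h; rewrite primC subr_le0.
have -> : moma a (1 *: K + (- delta)%:P) = moma a K - delta.
  rewrite -[in RHS](mul1r (moma a K)) -[X in _ = _ + X](momaC a).
  exact: (mom_linear (fun i : nat => i.+1%:R `^ (- (1 + a)))).
have {lo} : s * (1 - delta) * g <= moma a K.
  by rewrite -(ler_pM2l G0) mulrCA [G * g]mulrC gG; move: lo; rewrite K1 -/G; lra.
rewrite -/g.
have : 0 <= g * tau * delta by exact: ltW (mulr_gt0 (mulr_gt0 g0 tau0) delta0).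
have : 0 <= delta * eps by exact: ltW (mulr_gt0 delta0 eps0).
rewrite /s; lra.
Qed.

End Approximants.

(** * Generating functions and Galton-Watson processes *)

Section NatMeasurable.
Context (R : realType) (d : measure_display) (T : measurableType d).

Lemma measurable_nat_preimage (Y : T -> nat) (B : set nat) :
  measurable_fun setT Y -> measurable (Y @^-1` B).
Proof. by move=> mY; rewrite -[X in measurable X]setTI; exact: mY. Qed.

Lemma measurable_comp_nat (Y : T -> nat) (h : nat -> R) (D : set T) :
  measurable_fun setT Y -> measurable_fun D (h \o Y).
Proof.
move=> mY; apply: measurable_funTS => _ B mB; rewrite setTI comp_preimage.
exact: measurable_nat_preimage.
Qed.

Lemma measurable_nat_fibers (Y : T -> nat) :
  (forall k, measurable (Y @^-1` [set k])) -> measurable_fun setT Y.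
Proof.
move=> mY _ B _; rewrite setTI.
have -> : Y @^-1` B = \bigcup_(k in B) (Y @^-1` [set k]).
  by apply/seteqP; split => [w Bw|w [k Bk /= Ywk]]; [exists (Y w)|rewrite /= Ywk].
by apply: bigcup_measurable => k _; exact: mY.
Qed.

End NatMeasurable.

(** * Expectations of functions of integer-valued variables *)

Section NatValued.
Context (R : realType) (d : measure_display) (T : measurableType d) (P : probability T R).

Lemma integral_nat_fibers (D : set T) (Y : T -> nat) (F : T -> \bar R) :
  measurable D -> measurable_fun setT Y -> measurable_fun D F -> (forall x, 0 <= F x)%E ->
  (\int[P]_(w in D) F w = \sum_(k <oo) \int[P]_(w in D `&` Y @^-1` [set k]) F w)%E.
Proof.
move=> mD mY mF F0.
have E : D = \bigcup_k (D `&` Y @^-1` [set k]).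
  by apply/seteqP; split => [w Dw|w [k _ []]//]; exists (Y w).
rewrite [in LHS]E; apply: ge0_integral_bigcup => //.
- by move=> k; apply: measurableI => //; exact: measurable_nat_preimage.
- by rewrite -E.
- apply/trivIsetP => i j _ _ ij; rewrite -subset0 => w [[_ /= Ei] [_ /= Ej]].
  by move: ij; rewrite -Ei -Ej eqxx.
Qed.

Lemma integral_nat_series (D : set T) (Y : T -> nat) (g : nat -> R) :
  measurable D -> measurable_fun setT Y -> (forall k, 0 <= g k) ->
  (\int[P]_(w in D) (g (Y w))%:E = \sum_(k <oo) (g k)%:E * P (D `&` Y @^-1` [set k]))%E.
Proof.
move=> mD mY g0; rewrite (@integral_nat_fibers _ Y)//; last 2 first.
- by apply/measurable_EFinP; exact: measurable_comp_nat.
- by move=> w; rewrite lee_fin.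
apply: eq_eseriesr => k _; rewrite -integral_cst//; last first.
  by apply: measurableI => //; exact: measurable_nat_preimage.
by apply: eq_integral => w; rewrite inE => -[_ /= ->].
Qed.

Definition mean (Y : T -> nat) (h : nat -> R) : R := \int[P]_w h (Y w).

Lemma integrable_comp_nat (Y : T -> nat) (h : nat -> R) (M : R) :
  measurable_fun setT Y -> (forall k, `|h k| <= M) ->
  P.-integrable setT (EFin \o (fun w => h (Y w))).
Proof.
move=> mY hM; have := finite_measure_integrable_cst P M measurableT.
apply: le_integrable => //.
  by apply/measurable_EFinP; exact: measurable_comp_nat.
by move=> w _ /=; rewrite lee_fin (le_trans (hM _))// ler_norm.
Qed.

Lemma mean_le (Y : T -> nat) (g h : nat -> R) (M : R) : measurable_fun setT Y ->
  (forall k, `|g k| <= M) -> (forall k, `|h k| <= M) -> (forall k, g k <= h k) ->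
  mean Y g <= mean Y h.
Proof.
move=> mY gM hM gh; apply: le_Rintegral => //.
- exact: integrable_comp_nat gM.
- exact: integrable_comp_nat hM.
Qed.

Lemma mean_linear (Y : T -> nat) (g h : nat -> R) (b M : R) : measurable_fun setT Y ->
  (forall k, `|g k| <= M) -> (forall k, `|h k| <= M) ->
  mean Y (fun k => b * g k + h k) = b * mean Y g + mean Y h.
Proof.
move=> mY gM hM; have ig := integrable_comp_nat mY gM; have ih := integrable_comp_nat mY hM.
rewrite /mean RintegralD//; last exact: (integrableZl measurableT b ig).
by rewrite (RintegralZl b measurableT ig).
Qed.

Lemma mean_cst (Y : T -> nat) (c : R) : mean Y (fun=> c) = c.
Proof.
rewrite /mean /Rintegral (integral_cst P measurableT c%:E).
transitivity (fine (c%:E * 1)%E); last by rewrite mule1.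
by congr (fine (_ * _)%E); exact: probability_setT.
Qed.

Lemma mean_sum (I : Type) (r : seq I) (c : I -> R) (g : I -> nat -> R) (V : {RV P >-> nat}) :
  (forall i z, `|g i z| <= 1) ->
  (exists M, forall z, `|\sum_(i <- r) c i * g i z| <= M) /\
  mean V (fun z => \sum_(i <- r) c i * g i z) = \sum_(i <- r) c i * mean V (g i).
Proof.
move=> g1; elim: r => [|i r [[M HM] IH]].
  split; first by exists 0 => z; rewrite big_nil normr0.
  by under eq_fun do rewrite big_nil; rewrite big_nil mean_cst.
split.
  exists (`|c i| + M) => z; rewrite big_cons (le_trans (ler_normD _ _))// lerD//.
  by rewrite normrM ler_piMr.
under eq_fun do rewrite big_cons.
rewrite big_cons -IH (@mean_linear _ _ _ _ (1 + `|M|))// => [z|z].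
  by rewrite (le_trans (g1 _ _))// lerDl.
by rewrite (le_trans (HM z))// (le_trans (ler_norm M))// lerDr.
Qed.

Lemma mean_indic (Y : T -> nat) (B : set nat) : measurable_fun setT Y ->
  mean Y \1_B = fine (P (Y @^-1` B)).
Proof.
move=> mY; rewrite /mean /Rintegral; congr fine.
rewrite -[Y @^-1` B in RHS]setIT -integral_indic//; last exact: measurable_nat_preimage.
Qed.

Lemma norm_indic_le1 (B : set nat) z : `|\1_B z : R| <= 1.
Proof. by rewrite indicE; case: (_ \in _); rewrite ?normr1// normr0. Qed.

Lemma pgfE (Y : {RV P >-> nat}) s : pgf Y s = mean Y (fun k => s ^+ k).
Proof. by rewrite /pgf /mean /Rintegral unlock. Qed.

Lemma norm_exprn_le1 (s : R) k : 0 <= s <= 1 -> `|s ^+ k| <= 1.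
Proof. by move=> /andP[s0 s1]; rewrite ger0_norm ?exprn_ge0// exprn_ile1. Qed.

Lemma pgf_in01 (Y : {RV P >-> nat}) s : 0 <= s <= 1 -> 0 <= pgf Y s <= 1.
Proof.
move=> s01; have [s0 s1] := andP s01; rewrite pgfE; apply/andP; split.
  by apply: Rintegral_ge0 => w _; exact: exprn_ge0.
rewrite -[leRHS](mean_cst Y 1); apply: (@mean_le _ _ _ 1) => //.
- by move=> k; exact: norm_exprn_le1.
- by move=> k; rewrite normr1.
- by move=> k; rewrite exprn_ile1.
Qed.

Lemma EFin_pgf (Y : {RV P >-> nat}) s : 0 <= s <= 1 ->
  (\int[P]_w (s ^+ Y w)%:E = (pgf Y s)%:E)%E.
Proof.
move=> s01; rewrite pgfE /mean /Rintegral fineK//.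
apply: (integrable_fin_num measurableT).
exact: (integrable_comp_nat (measurable_funP Y) (fun k => norm_exprn_le1 k s01)).
Qed.

Lemma pgf_le (Y : {RV P >-> nat}) s t : 0 <= s -> s <= t -> t <= 1 -> pgf Y s <= pgf Y t.
Proof.
move=> s0 st t1; have t0 := le_trans s0 st; have s1 := le_trans st t1.
rewrite !pgfE; apply: (@mean_le _ _ _ 1) => //.
- by move=> k; apply: norm_exprn_le1; rewrite s0.
- by move=> k; apply: norm_exprn_le1; rewrite t0.
- by move=> k; rewrite lerXn2r ?nnegrE.
Qed.

(* [(1 - s ^+ k) / (1 - s) = \sum_(i < k) s ^+ i] increases with [s]. *)
Lemma pgf_slope (Y : {RV P >-> nat}) x y : 0 < x -> x <= y -> y <= 1 ->
  x * (1 - pgf Y (1 - y)) <= y * (1 - pgf Y (1 - x)).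
Proof.
move=> x0 xy y1.
have y0 : 0 < y by exact: lt_le_trans xy.
have x1 : x <= 1 by exact: le_trans y1.
have z01 (z : R) : 0 < z -> z <= 1 -> 0 <= 1 - z <= 1.
  by move=> ? ?; apply/andP; split; lra.
have E (c z : R) : 0 < z -> z <= 1 -> c * (1 - pgf Y (1 - z)) =
    mean Y (fun k => (- c) * (1 - z) ^+ k + c).
  move=> z0 z1; rewrite (@mean_linear _ _ _ _ (1 + `|c|))//.
  - by rewrite mean_cst pgfE; ring.
  - by move=> k; apply: (le_trans (norm_exprn_le1 k (z01 z z0 z1))); rewrite lerDl.
  - by move=> k; rewrite lerDr.
have bnd (c z : R) k : 0 < c -> c <= 1 -> 0 < z -> z <= 1 -> `|- c * (1 - z) ^+ k + c| <= 1.
  move=> c0 c1 zp z1; have := norm_exprn_le1 k (z01 z zp z1).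
  have /andP[zz _] := z01 z zp z1; have := exprn_ge0 k zz.
  by move=> h1; rewrite (ger0_norm h1) => h2; rewrite ler_norml; apply/andP; split; nra.
rewrite !E//; apply: (@mean_le _ _ _ 1) => //.
- by move=> k; exact: bnd.
- by move=> k; exact: bnd.
move=> k.
have S (z : R) : (1 - z) ^+ k = 1 - z * \sum_(i < k) (1 - z) ^+ i.
  by have := subrX1 (1 - z) k; move/eqP; rewrite subr_eq => /eqP ->; ring.
have : \sum_(i < k) (1 - y) ^+ i <= \sum_(i < k) (1 - x) ^+ i.
  by apply: ler_sum => i _; rewrite lerXn2r ?nnegrE//; lra.
rewrite -(ler_pM2l (mulr_gt0 x0 y0)) !S; lra.
Qed.

End NatValued.

(** * Events independent of a set of offspring counts *)

Section Independence.
Context (R : realType) (d : measure_display) (T : measurableType d) (P : probability T R).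
Variable X : nat * nat -> {RV P >-> nat}.

Definition cylinder (J : {fset nat * nat}) (B : nat * nat -> set nat) : set T :=
  \bigcap_(i in [set` J]) (X i @^-1` B i).

(** Tested on finite cylinders, the form of [mutually_independent]; [S] holds the indices that [A]
    has not consumed, and shrinks one index at a time. *)
Definition indep_from (S : set (nat * nat)) (A : set T) : Prop :=
  forall (J : {fset nat * nat}) B, [set` J] `<=` S ->
    P (A `&` cylinder J B) = (P A * \prod_(i <- J) P (X i @^-1` B i))%E.

Lemma measurable_X i B : measurable (X i @^-1` B).
Proof. exact: measurable_nat_preimage (measurable_funP (X i)). Qed.

Lemma measurable_cylinder J B : measurable (cylinder J B).
Proof.
apply: fin_bigcap_measurable => // i _; exact: measurable_X.
Qed.

Lemma indep_fromW S S' A : S' `<=` S -> indep_from S A -> indep_from S' A.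
Proof. by move=> SS' h J B JS; apply: h; exact: subset_trans SS'. Qed.

Lemma indep_from0 S : indep_from S set0.
Proof. by move=> J B _; rewrite set0I measure0 mul0e. Qed.

Lemma indep_from_preimage S A i C : indep_from S A -> S i ->
  P (A `&` X i @^-1` C) = (P A * P (X i @^-1` C))%E.
Proof.
move=> h Si; have := h [fset i]%fset (fun=> C).
rewrite big_seq_fset1 => <-; last by move=> j; rewrite /= inE => /eqP ->.
congr (P (_ `&` _)); apply/seteqP; split => [w Xw j /=|w]; first by rewrite inE => /eqP ->.
by apply; rewrite /= inE.
Qed.

(** The condition on [X i] joins the cylinder as one more coordinate, which consumes [i]. *)
Lemma indep_fromI S A i C : indep_from S A -> S i ->
  indep_from (S `\ i) (A `&` X i @^-1` C).
Proof.
move=> h Si J B JS.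
have iJ : i \notin J by apply/negP => /JS[_]; exact.
pose B' j := if j == i then C else B j.
have -> : A `&` X i @^-1` C `&` cylinder J B = A `&` cylinder (i |` J)%fset B'.
  rewrite -setIA; congr (_ `&` _); apply/seteqP; split => [w [Xw Jw] j /=|w Jw].
    rewrite in_fset1U /B'; case: eqVneq => [-> //|ji /= jJ]; exact: Jw.
  split; first by have := Jw i; rewrite /= in_fset1U eqxx /B' eqxx; exact.
  move=> j /= jJ; have := Jw j; rewrite /= in_fset1U jJ orbT /B'.
  by case: eqVneq => [ji|_]; [move: iJ; rewrite -ji jJ|exact].
rewrite h; last first.
  by move=> j; rewrite /= in_fset1U => /orP[/eqP ->//|/JS[]].
rewrite big_fsetU1//= (indep_from_preimage _ h Si) -muleA /B' eqxx; congr (_ * (_ * _))%E.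
apply: eq_big_seq => j jJ; case: eqVneq => // ji.
by move: iJ; rewrite -ji jJ.
Qed.

Lemma indep_from_bigcup S (A : nat -> set T) : (forall k, measurable (A k)) ->
  trivIset setT A -> (forall k, indep_from S (A k)) -> indep_from S (\bigcup_k A k).
Proof.
move=> mA tA h J B JS; rewrite setI_bigcupl.
have mU : measurable (\bigcup_k A k) by exact: bigcup_measurable.
rewrite measure_semi_bigcup; first last.
- rewrite -setI_bigcupl; apply: measurableI => //; exact: measurable_cylinder.
- apply/trivIsetP => i j _ _ ij; rewrite setIACA.
  by move/trivIsetP : tA => /(_ i j I I ij) ->; rewrite set0I.
- by move=> k; apply: measurableI => //; exact: measurable_cylinder.
rewrite (measure_semi_bigcup _ mA tA mU).
have fp : (\prod_(i <- J) P (X i @^-1` B i))%E \is a fin_num.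
  by apply: prode_fin_num => i _; apply: fin_num_measure; exact: measurable_X.
rewrite -(fineK fp) muleC -nneseriesZl//; apply: eq_eseriesr => k _.
by rewrite /= (h k J B JS) muleC fineK.
Qed.

End Independence.

(** * The generating function of generation [n] *)

Section GaltonWatson.
Context (R : realType) (d : measure_display) (T : measurableType d) (P : probability T R).
Variables (xi : {RV P >-> nat}) (Z : nat -> {RV P >-> nat}) (X : nat * nat -> {RV P >-> nat}).
Hypothesis X_indep : mutually_independent X.
Hypothesis X_dist : forall ni, identically_distributed (X ni) xi.
Hypothesis Z0 : forall w, Z 0%N w = 1%N.
Hypothesis ZS : forall n w, Z n.+1 w = (\sum_(i < Z n w) X (n, val i) w)%N.

(** The number of parents [l] is deterministic; the random sum [Z n.+1] is recovered on the event
    [Z n = l]. *)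
Definition offspring (n l : nat) (w : T) : nat := (\sum_(i < l) X (n, val i) w)%N.

(** Counts not yet revealed once the first [l] individuals of generation [n] have reproduced. *)
Definition future (n l : nat) : set (nat * nat) :=
  [set mi | (n < mi.1)%N || ((mi.1 == n) && (l <= mi.2)%N)].


Lemma offspringS n l w : offspring n l.+1 w = (offspring n l w + X (n, l) w)%N.
Proof. by rewrite /offspring big_ord_recr. Qed.

Lemma offspringS_fiber n l k : offspring n l.+1 @^-1` [set k] =
  \bigcup_a (offspring n l @^-1` [set a] `&` X (n, l) @^-1` [set b | (a + b)%N = k]).
Proof.
apply/seteqP; split => [w /= <-|w [a _ [/= <- <-]]]; last by rewrite offspringS.
by exists (offspring n l w) => //; split => //=; rewrite offspringS.
Qed.

Lemma measurable_offspring n l : measurable_fun setT (offspring n l).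
Proof.
elim: l => [|l IH].
  rewrite (_ : offspring n 0 = cst 0%N); first exact: measurable_cst.
  by apply/funext => w; rewrite /offspring big_ord0.
apply: measurable_nat_fibers => k; rewrite offspringS_fiber.
apply: bigcupT_measurable => a; apply: measurableI; last exact: measurable_X.
exact: measurable_nat_preimage.
Qed.

Lemma measurable_Z n j : measurable (Z n @^-1` [set j]).
Proof. exact: measurable_nat_preimage (measurable_funP (Z n)). Qed.

Lemma measurable_ZW n l j k :
  measurable (Z n @^-1` [set j] `&` offspring n l @^-1` [set k]).
Proof.
apply: measurableI; first exact: measurable_Z.
exact: measurable_nat_preimage (measurable_offspring n l).
Qed.

(** Adding parent [l] splits the event over the earlier totals [a]; each piece consumes the index
    [(n, l)] alone, which leaves [future n l.+1]. *)
Lemma offspring_indep n l : (forall j, indep_from X (future n 0) (Z n @^-1` [set j])) ->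
  forall j k, indep_from X (future n l) (Z n @^-1` [set j] `&` offspring n l @^-1` [set k]).
Proof.
move=> hZ; elim: l => [|l IH] j k.
  have -> : Z n @^-1` [set j] `&` offspring n 0 @^-1` [set k] =
      if k == 0%N then Z n @^-1` [set j] else set0.
    have off0 w : offspring n 0 w = 0%N by rewrite /offspring big_ord0.
    apply/seteqP; split => [w [/= Zw]|w /=]; rewrite off0.
      by case: eqVneq => // k0 /esym; move/eqP: k0.
    by case: eqVneq => // ->.
  by case: eqVneq => _; [exact: hZ|exact: indep_from0].
rewrite offspringS_fiber setI_bigcupr; apply: indep_from_bigcup.
- move=> a; rewrite setIA; apply: measurableI; last exact: measurable_X.
  exact: measurable_ZW.
- apply/trivIsetP => a b _ _ ab; rewrite -subset0 => w [[_ [/= Ea _]] [_ [/= Eb _]]].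
  by move: ab; rewrite -Ea -Eb eqxx.
move=> a; rewrite setIA; apply: (@indep_fromW _ _ _ _ _ (future n l `\ (n, l))).
  move=> [m i]; rewrite /future /= => /orP[nm|/andP[/eqP -> li]].
    by rewrite nm; split => // -[mn _]; move: nm; rewrite mn ltnn.
  by rewrite eqxx (ltnW li) orbT; split => // -[il]; move: li; rewrite il ltnn.
by apply: indep_fromI => //=; rewrite /future /= eqxx leqnn orbT.
Qed.

Lemma ZS_fiber n k : Z n.+1 @^-1` [set k] =
  \bigcup_l (Z n @^-1` [set l] `&` offspring n l @^-1` [set k]).
Proof.
apply/seteqP; split => [w /= <-|w [l _ [/= <- <-]]]; last by rewrite ZS.
by exists (Z n w) => //; split => //=; rewrite ZS.
Qed.

(** Splitting [Z n.+1] over [Z n = l] gives disjoint events on generation [n] and before, which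
    leave the later generations untouched. The induction starts from [X_indep], as [Z 0] is
    constant. *)
Lemma Z_indep n j : indep_from X (future n 0) (Z n @^-1` [set j]).
Proof.
elim: n j => [|n IH] j.
  have -> : Z 0%N @^-1` [set j] = if j == 1%N then setT else set0.
    apply/seteqP; split => [w /=|w]; first by rewrite Z0 => <-.
    by case: eqVneq => // -> _ /=; rewrite Z0.
  case: eqVneq => _; last exact: indep_from0.
  by move=> J B _; rewrite setTI probability_setT mul1e; exact: X_indep.
rewrite ZS_fiber; apply: indep_from_bigcup.
- by move=> l; exact: measurable_ZW.
- apply/trivIsetP => a b _ _ ab; rewrite -subset0 => w [[/= Ea _] [/= Eb _]].
  by move: ab; rewrite -Ea -Eb eqxx.
move=> l; apply: (@indep_fromW _ _ _ _ _ (future n l)); last exact: offspring_indep.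
move=> [m i]; rewrite /future /= => /orP[nm|/andP[/eqP -> _]]; first by rewrite (ltnW nm).
by rewrite ltnSn.
Qed.

Section Step.
Variable s : R.
Hypothesis s01 : 0 <= s <= 1.

Let s_ge0 k : 0 <= s ^+ k. Proof. by rewrite exprn_ge0//; case/andP: s01. Qed.

Let measurable_sW n l (D : set T) : measurable_fun D (fun w => (s ^+ offspring n l w)%:E).
Proof.
apply/measurable_EFinP.
exact: (measurable_comp_nat (fun k => s ^+ k) (measurable_offspring n l)).
Qed.

Lemma pgf_series : ((pgf xi s)%:E = \sum_(k <oo) (s ^+ k)%:E * P (xi @^-1` [set k]))%E.
Proof.
rewrite -EFin_pgf// (integral_nat_series P _ (measurable_funP xi))//.
by apply: eq_eseriesr => k _; rewrite setTI.
Qed.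

(** [Z n] and the first [l] counts do not involve [X (n, l)], so restricting to a value of the
    latter only contributes its probability, which is that of [xi]. *)
Lemma integral_offspring_slice n l j b :
  (\int[P]_(w in Z n @^-1` [set j] `&` X (n, l) @^-1` [set b]) (s ^+ offspring n l w)%:E =
   P (xi @^-1` [set b]) * \int[P]_(w in Z n @^-1` [set j]) (s ^+ offspring n l w)%:E)%E.
Proof.
have mD : measurable (Z n @^-1` [set j] `&` X (n, l) @^-1` [set b]).
  by apply: measurableI; [exact: measurable_Z|exact: measurable_X].
rewrite !(integral_nat_series P (g := fun k => s ^+ k) _ (measurable_offspring n l))//; last first.
  exact: measurable_Z.
have fp : P (xi @^-1` [set b]) \is a fin_num.
  by apply: fin_num_measure; exact: measurable_nat_preimage (measurable_funP xi).
rewrite -(fineK fp) -nneseriesZl; last by move=> i _; rewrite mule_ge0// lee_fin.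
apply: eq_eseriesr => k _; rewrite fineK// setIAC.
rewrite (indep_from_preimage _ (offspring_indep (l := l) (@Z_indep n) j k)); last first.
  by rewrite /future /= eqxx leqnn orbT.
rewrite [P (X _ @^-1` _)](X_dist (n, l) (B := [set b])) //.
by rewrite muleA muleC.
Qed.

Lemma integral_offspring n l j :
  (\int[P]_(w in Z n @^-1` [set j]) (s ^+ offspring n l w)%:E =
   (pgf xi s ^+ l)%:E * P (Z n @^-1` [set j]))%E.
Proof.
elim: l => [|l IH].
  under eq_integral do rewrite /offspring big_ord0 expr0.
  by rewrite integral_cst//; exact: measurable_Z.
have mD := measurable_Z n j.
have F0 w : (0 <= (s ^+ offspring n l.+1 w)%:E)%E by rewrite lee_fin.
rewrite (integral_nat_fibers P mD (measurable_funP (X (n, l))) (@measurable_sW n l.+1 _) F0).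
transitivity (\sum_(b <oo) ((pgf xi s ^+ l)%:E * P (Z n @^-1` [set j])) *
    ((s ^+ b)%:E * P (xi @^-1` [set b])))%E.
  apply: eq_eseriesr => b _.
  transitivity (\int[P]_(w in Z n @^-1` [set j] `&` X (n, l) @^-1` [set b])
      ((s ^+ b)%:E * (s ^+ offspring n l w)%:E))%E.
    apply: eq_integral => w; rewrite inE => -[_ /= Xb].
    by rewrite offspringS Xb addnC exprD EFinM.
  have mDb : measurable (Z n @^-1` [set j] `&` X (n, l) @^-1` [set b]).
    by apply: measurableI => //; exact: measurable_X.
  rewrite (ge0_integralZl_EFin P mDb _ (@measurable_sW n l _))//; last first.
    by move=> w _; rewrite lee_fin.
  by rewrite integral_offspring_slice IH muleA muleC.
have fp : P (Z n @^-1` [set j]) \is a fin_num by apply: fin_num_measure.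
rewrite -(fineK fp) -EFinM nneseriesZl; last by move=> b _; rewrite mule_ge0// lee_fin.
by rewrite -pgf_series -!EFinM exprSr mulrAC.
Qed.

(** Splitting over [Z n = l], where [Z n.+1] is a sum of [l] offspring counts, puts [pgf xi] on the
    inside. *)
Lemma pgf_Z_step n : pgf (Z n.+1) s = pgf (Z n) (pgf xi s).
Proof.
have f01 := pgf_in01 xi s01.
apply: EFin_inj; rewrite -!EFin_pgf//.
rewrite (integral_nat_fibers P _ (measurable_funP (Z n)))//; last 2 first.
- apply/measurable_EFinP.
  exact: (measurable_comp_nat (fun k => s ^+ k) (measurable_funP (Z n.+1))).
- by move=> w; rewrite lee_fin.
rewrite (integral_nat_series P (g := fun k => pgf xi s ^+ k) _
  (measurable_funP (Z n)))//; last first.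
  by move=> k; rewrite exprn_ge0//; case/andP: f01.
apply: eq_eseriesr => l _; rewrite !setTI -integral_offspring.
by apply: eq_integral => w; rewrite inE /= => Zl; rewrite ZS Zl.
Qed.

End Step.

Lemma pgf_Z n s : 0 <= s <= 1 -> pgf (Z n) s = iter n (pgf xi) s.
Proof.
elim: n s => [|n IH] s s01.
  rewrite pgfE /mean; under eq_Rintegral do rewrite Z0 expr1.
  exact: (mean_cst P (Z 0%N) s).
by rewrite pgf_Z_step// IH ?pgf_in01// iterSr.
Qed.

End GaltonWatson.

(** * Probability of a small population *)

Section SmallPopulation.
Context (R : realType) (d : measure_display) (T : measurableType d) (P : probability T R).
Variables (alpha : R) (xi : {RV P >-> nat}) (L : R -> R).
Hypothesis alpha01 : 0 < alpha < 1.
Hypothesis hL : slowly_varying_at0 L.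
Hypothesis hf : forall s : R, 0 <= s <= 1 ->
  pgf xi s = s + (1 - s) `^ (1 + alpha) * L (1 - s).

Let alpha_gt0 : 0 < alpha. Proof. by case/andP: alpha01. Qed.

Definition reg_var (q : R) : R := q `^ alpha * L q.
Local Notation psi := reg_var.

Lemma reg_var_gt0 (q : R) : 0 < q <= 1 -> 0 < psi q.
Proof.
move=> q01; have [Lpos _ _] := hL; have [q0 _] := andP q01.
by rewrite mulr_gt0 ?powR_gt0// Lpos.
Qed.

Lemma pgf_decay (q : R) : 0 < q <= 1 -> pgf xi (1 - q) = 1 - decay psi q.
Proof.
move=> /andP[q0 q1]; rewrite hf; last by apply/andP; split; lra.
have -> : 1 - (1 - q) = q by ring.
rewrite powRD; last by rewrite (gt_eqF q0) implybT.
by rewrite powRr1 ?(ltW q0)// /decay /psi; ring.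
Qed.

(* Monotonicity stands in for the uniform convergence theorem of regular
   variation. *)
Lemma reg_var_le (x y : R) : 0 < x -> x <= y -> y <= 1 -> psi x <= psi y.
Proof.
move=> x0 xy y1; have y0 : 0 < y by exact: lt_le_trans xy.
have := pgf_slope xi x0 xy y1; rewrite !pgf_decay ?x0 ?y0 ?(le_trans xy)//.
rewrite /decay => H; rewrite -(ler_pM2l (mulr_gt0 x0 y0)); lra.
Qed.

Lemma reg_var_rv (c : R) : 0 < c -> psi (c * z) / psi z @[z --> 0^'+] --> c `^ alpha.
Proof.
move=> c0; have [Lpos _ Lsv] := hL.
have : c `^ alpha * (L (c * z) / L z) @[z --> 0^'+] --> c `^ alpha * 1.
  by apply: cvgMr; exact: Lsv.
rewrite mulr1; apply: cvg_trans; apply: near_eq_cvg; near=> z.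
have z0 : 0 < z by [].
have Lz : 0 < L z.
  by apply: Lpos; rewrite z0/=; near: z; exact: nbhs_right_le.
have za : 0 < z `^ alpha by exact: powR_gt0.
by rewrite /psi powRM ?(ltW c0) ?(ltW z0)//; field; rewrite !gt_eqF.
Unshelve. all: by end_near. Qed.

(** A value [psi q >= 1] means [pgf xi (1 - q) >= 1]; as the generating function increases, [psi]
    would be at least 1 at every smaller argument too, against [psi_cvg0]. *)
Lemma reg_var_lt1 (q : R) : 0 < q <= 1 -> psi q < 1.
Proof.
move=> q01; have [q0 q1] := andP q01; rewrite ltNge; apply/negP => psi1.
have psi_ge1 z : 0 < z -> z <= q -> 1 <= psi z.
  move=> z0 zq; have z1 := le_trans zq q1.
  have : pgf xi (1 - q) <= pgf xi (1 - z) by apply: pgf_le; lra.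
  rewrite !pgf_decay ?z0// /decay => h.
  rewrite leNgt; apply/negP => lt1.
  have : 0 < z * (1 - psi z) by rewrite mulr_gt0// subr_gt0.
  have : q * (1 - psi q) <= 0 by rewrite pmulr_rle0// subr_le0.
  lra.
have /cvgr_lt /(_ _ (ltr01)) H := psi_cvg0 alpha_gt0 reg_var_gt0 reg_var_le reg_var_rv.
have [z [[z0 lt1] zq]] : exists z, (0 < z /\ psi z < 1) /\ z <= q.
  apply: (@filter_ex _ _ (at_right_proper_filter (0 : R))).
  near=> z; split; first by split => //; near: z.
  by near: z; exact: nbhs_right_le.
by move: lt1; rewrite ltNge psi_ge1.
Unshelve. all: by end_near. Qed.

Lemma decay_reg_var_le (x y : R) : 0 < x -> x <= y -> y <= 1 -> decay psi x <= decay psi y.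
Proof.
move=> x0 xy y1; have y0 : 0 < y by exact: lt_le_trans xy.
have : pgf xi (1 - y) <= pgf xi (1 - x) by apply: pgf_le; lra.
by rewrite !pgf_decay ?x0 ?y0 ?(le_trans xy)//; lra.
Qed.

Local Notation Q := (decay_seq psi).

Lemma iter_pgf n (q : R) : 0 < q <= 1 -> iter n (pgf xi) (1 - q) = 1 - iter n (decay psi) q.
Proof.
move=> q01; elim: n => //= n ->; rewrite pgf_decay//.
exact: (iter_decay_in01 reg_var_gt0 reg_var_lt1).
Qed.

Lemma survival n : 1 - iter n (pgf xi) 0 = Q n.
Proof.
have := @iter_pgf n 1; rewrite subrr lexx ltr01 => /(_ isT) ->.
by rewrite opprB addrC subrK.
Qed.

Let QS := (Q_gt0 reg_var_gt0 reg_var_lt1).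
Let Qcv := (Q_cvg0 reg_var_gt0 reg_var_lt1 reg_var_le).

Variable Z : nat -> {RV P >-> nat}.
Hypothesis pgfZ : forall n s, 0 <= s <= 1 -> pgf (Z n) s = iter n (pgf xi) s.
Variable m : nat -> nat.
Hypothesis m_y : m n @[n --> \oo] --> \oo.
Hypothesis m_small : (m n)%:R / n%:R @[n --> \oo] --> (0 : R).

Local Notation Y n := (expR (- Q (m n))).
Local Notation w n := (Q n / (alpha * n%:R) * (m n)%:R).

Lemma Y_in01 n k : 0 <= Y n ^+ k <= 1.
Proof.
by rewrite exprn_ge0 ?expR_ge0//= exprn_ile1 ?expR_ge0// expR_le1 oppr_le0 ltW.
Qed.

Lemma YX_lt1 n k : Y n ^+ k.+1 < 1.
Proof. by rewrite exprn_ilt1 ?expR_ge0// expR_lt1 oppr_lt0. Qed.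

(** For [t = k.+1 * Q (m n)], the number [1 - expR (- t)] lies between [t / (1 + t)] and [t]. *)
Lemma YX_cvg k : (1 - Y n ^+ k.+1) / Q (m n) @[n --> \oo] --> (k.+1%:R : R).
Proof.
have Qm : Q (m n) @[n --> \oo] --> (0 : R) by exact: (cvg_comp _ _ m_y Qcv).
have k0 : 0 < k.+1%:R :> R by [].
apply: (@squeeze_cvgr _ _ _ _ (fun n => k.+1%:R / (1 + k.+1%:R * Q (m n))) (fun=> k.+1%:R)).
- near=> n; have q0 := QS (m n).
  set t := k.+1%:R * Q (m n); have t0 : 0 < t by rewrite mulr_gt0.
  have -> : Y n ^+ k.+1 = expR (- t) by rewrite -expRM_natl mulrN.
  rewrite ler_pdivlMr// ler_pdivrMr//; apply/andP; split; last first.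
    by have := expR_ge1Dx (- t); rewrite -/t; lra.
  rewrite mulrAC -/t ler_pdivrMr ?addr_gt0// expRN.
  have e0 := expR_gt0 t; have e1 := expR_ge1Dx t.
  have : (1 + t) / expR t <= 1 by rewrite ler_pdivrMr// mul1r.
  lra.
- rewrite -[X in _ --> X](_ : k.+1%:R / (1 + k.+1%:R * 0) = k.+1%:R); last first.
    by rewrite mulr0 addr0 divr1.
  apply: cvgMr; apply: cvgV; first by rewrite mulr0 addr0 oner_eq0.
  by apply: cvgD; [exact: cvg_cst|exact: cvgMr].
- exact: cvg_cst.
Unshelve. all: by end_near. Qed.

(** This is [laplace_cvg] with [lam = k.+1], started at [1 - Y n ^+ k.+1]; integer parameters
    suffice for polynomials in [Y n ^+ z]. *)
Lemma pgf_increment_cvg k :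
  (pgf (Z n) (Y n ^+ k.+1) - pgf (Z n) 0) / w n @[n --> \oo] --> (k.+1%:R : R) `^ (- alpha).
Proof.
have y01 n : 0 < 1 - Y n ^+ k.+1 <= 1.
  by rewrite subr_gt0 YX_lt1/= lerBlDr lerDl; case/andP: (Y_in01 n k.+1).
have := laplace_cvg alpha_gt0 reg_var_gt0 reg_var_lt1 reg_var_le reg_var_rv
  decay_reg_var_le m_y m_small y01 (ltr0Sn R k) (@YX_cvg k).
apply: cvg_trans; apply: near_eq_cvg; apply: nearW => n.
rewrite !pgfZ ?Y_in01 ?lexx ?ler01//; congr (_ / _).
have := iter_pgf n (y01 n); rewrite subKr => ->.
by have := survival n; set A := iter n (pgf xi) 0 => <-; ring.
Qed.

(* Subtracting the value at [0 ^+ z] (which is [1] at [z = 0] and [0] elsewhere)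
   removes the atom of [Z n] at [0]. *)
Definition increment (n : nat) (K : {poly R}) (z : nat) : R :=
  (prim K).[Y n ^+ z] - (prim K).[0 ^+ z].

Lemma incrementE n K z :
  increment n K z = \sum_(i < size K) K`_i / i.+1%:R * ((Y n ^+ i.+1) ^+ z - 0 ^+ z).
Proof.
rewrite /increment !horner_prim /mom -sumrB; apply: eq_bigr => i _.
have -> : (0 ^+ z) ^+ i.+1 = 0 ^+ z :> R.
  case: z => [|z]; first by rewrite expr0 expr1n.
  by have -> : 0 ^+ z.+1 = 0 :> R; rewrite expr0n.
by rewrite -!exprM mulnC; ring.
Qed.

Lemma increment_terms n i z : `|(Y n ^+ i.+1) ^+ z - 0 ^+ z| <= 1.
Proof.
have [h1 h2] := andP (Y_in01 n (i.+1 * z)); rewrite exprM in h1 h2.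
have : 0 <= (0 : R) ^+ z <= 1 by case: z {h1 h2} => [|z]; rewrite ?expr0 ?exprS ?mul0r lexx ler01.
by move=> /andP[? ?]; rewrite ler_norml; apply/andP; split; lra.
Qed.

Lemma increment_bounded n K : exists M, forall z, `|increment n K z| <= M.
Proof.
have [[M HM] _] := mean_sum (index_enum 'I_(size K)) (fun i => K`_i / i.+1%:R) (Z n)
  (fun i z => increment_terms n i z).
by exists M => z; rewrite incrementE.
Qed.

Lemma mean_increment n K : mean P (Z n) (increment n K) =
  \sum_(i < size K) K`_i / i.+1%:R * (pgf (Z n) (Y n ^+ i.+1) - pgf (Z n) 0).
Proof.
have [_ E] := mean_sum (index_enum 'I_(size K)) (fun i => K`_i / i.+1%:R) (Z n)
  (fun i z => increment_terms n i z).
rewrite (_ : increment n K = fun z => \sum_(i < size K) K`_i / i.+1%:R *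
  ((Y n ^+ i.+1) ^+ z - 0 ^+ z)); last by apply/funext => z; exact: incrementE.
rewrite E; apply: eq_bigr => i _; congr (_ * _).
rewrite (_ : (fun z => (Y n ^+ i.+1) ^+ z - 0 ^+ z) =
  (fun z => -1 * 0 ^+ z + (Y n ^+ i.+1) ^+ z)); last by apply/funext => z; ring.
rewrite (@mean_linear _ _ _ _ _ _ _ _ 1)//.
- by rewrite -!pgfE; ring.
- by move=> z; apply: norm_exprn_le1; rewrite lexx ler01.
- by move=> z; apply: norm_exprn_le1; exact: Y_in01.
Qed.

(** Dividing the coefficient of index [i] by [i.+1], as [prim] does, turns the exponent [- alpha]
    into [- (1 + alpha)]: integration by parts, read on coefficients. *)
Lemma mean_increment_cvg K : mean P (Z n) (increment n K) / w n @[n --> \oo] --> moma alpha K.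
Proof.
have E n : mean P (Z n) (increment n K) / w n =
  \sum_(i < size K) K`_i / i.+1%:R * ((pgf (Z n) (Y n ^+ i.+1) - pgf (Z n) 0) / w n).
  by rewrite mean_increment mulr_suml; apply: eq_bigr => i _; rewrite mulrA.
under eq_cvg do rewrite E.
have -> : moma alpha K = \sum_(i < size K) K`_i / i.+1%:R * i.+1%:R `^ (- alpha).
  apply: eq_bigr => i _; have i0 : 0 < i.+1%:R :> R by [].
  rewrite opprD powRD; last by rewrite (gt_eqF i0) implybT.
  by rewrite powR_inv1 ?(ltW i0)// mulrA.
apply: cvg_big => [|i _]; last by apply: cvgMr; exact: pgf_increment_cvg.
exact: add_continuous.
Qed.

Definition small (n : nat) : set nat := [set z | 0 < Q (m n) * z%:R <= 1].

Lemma YX_expR n z : Y n ^+ z = expR (- (Q (m n) * z%:R)).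
Proof. by rewrite -expRM_natr mulNr. Qed.

(** For [z > 0], membership in [small n] amounts to [expR (- 1) <= Y n ^+ z], the threshold of the
    approximants; at [z = 0] both sides vanish. *)
Lemma indic_small_le n K z : (forall y, 0 <= y <= 1 -> 0 <= (prim K).[y]) ->
  (forall y, expR (- 1) <= y <= 1 -> 1 <= (prim K).[y]) ->
  \1_(small n) z <= increment n K z.
Proof.
move=> K0 K1; rewrite /increment indicE.
case: z => [|z]; first by rewrite !expr0 subrr memNset//= /small/= mulr0 ltxx.
rewrite [0 ^+ z.+1]exprS mul0r prim0 subr0.
case: (boolP (z.+1 \in small n)) => [/set_mem/= /andP[_ h]|_]; last by rewrite K0// Y_in01.
apply: K1; have [_ ->] := andP (Y_in01 n z.+1); rewrite andbT YX_expR.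
by rewrite ler_expR lerN2.
Qed.

Lemma indic_small_ge n K z : (forall y, 0 <= y <= 1 -> (prim K).[y] <= 1) ->
  (forall y, 0 <= y <= expR (- 1) -> (prim K).[y] <= 0) ->
  increment n K z <= \1_(small n) z.
Proof.
move=> K1 K0; rewrite /increment indicE.
case: z => [|z]; first by rewrite !expr0 subrr.
rewrite [0 ^+ z.+1]exprS mul0r prim0 subr0.
case: (boolP (z.+1 \in small n)) => [_|/negP h]; first by rewrite K1// Y_in01.
apply: K0; have [-> _] := andP (Y_in01 n z.+1); rewrite YX_expR.
rewrite ler_expR lerN2 leNgt; apply/negP => lt1; apply: h.
by apply/mem_set; rewrite /small/= ltW// andbT mulr_gt0// QS.
Qed.

Lemma mean_small_cvg :
  mean P (Z n) \1_(small n) / w n @[n --> \oo] --> (Gamma (1 + alpha))^-1.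
Proof.
apply/cvgrPdist_le => eps eps0; have e2 : 0 < eps / 2 by rewrite divr_gt0.
have [K [K0 K1 Km]] := upper_approx alpha01 e2.
have [K' [K1' K0' Km']] := lower_approx alpha01 e2.
have h1 : \forall n \near \oo, mean P (Z n) (increment n K) / w n <= (Gamma (1 + alpha))^-1 + eps.
  have lt : moma alpha K < (Gamma (1 + alpha))^-1 + eps by apply: (le_lt_trans Km); lra.
  exact: (cvgr_le _ (@mean_increment_cvg K) _ lt).
have h2 : \forall n \near \oo, (Gamma (1 + alpha))^-1 - eps <= mean P (Z n) (increment n K') / w n.
  have lt : (Gamma (1 + alpha))^-1 - eps < moma alpha K' by apply: lt_le_trans Km'; lra.
  exact: (cvgr_ge _ (@mean_increment_cvg K') _ lt).
have w0 n : 0 <= (w n)^-1.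
  by rewrite invr_ge0 mulr_ge0// divr_ge0 ?(ltW (QS n))// mulr_ge0// ltW.
near=> n; rewrite ler_distlC; apply/andP; split.
  apply: (@le_trans _ _ (mean P (Z n) (increment n K') / w n)); first by near: n.
  have [M HM] := increment_bounded n K'.
  rewrite ler_wpM2r//; apply: (@mean_le _ _ _ _ _ _ _ (1 + `|M|)) => // z.
  - by rewrite (le_trans (HM z))// (le_trans (ler_norm M))// lerDr.
  - by rewrite (le_trans (norm_indic_le1 R _ _))// lerDl.
  - exact: indic_small_ge.
apply: (@le_trans _ _ (mean P (Z n) (increment n K) / w n)); last by near: n.
have [M HM] := increment_bounded n K.
rewrite ler_wpM2r//; apply: (@mean_le _ _ _ _ _ _ _ (1 + `|M|)) => // z.
- by rewrite (le_trans (norm_indic_le1 R _ _))// lerDl.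
- by rewrite (le_trans (HM z))// (le_trans (ler_norm M))// lerDr.
- exact: indic_small_le.
Unshelve. all: by end_near. Qed.

End SmallPopulation.

(** * Integer parts of [phi n] *)

Section TruncnAsymptotics.
Context (R : realType) (phi : nat -> R).
Hypothesis phi_y : phi n @[n --> \oo] --> +oo.

Lemma truncn_cvgy : Num.truncn (phi n) @[n --> \oo] --> \oo.
Proof.
apply/cvgnyPge => N; have /cvgryPge/(_ N%:R) := phi_y; apply: filterS => n Nphi.
by rewrite truncn_ge_nat// (le_trans _ Nphi).
Qed.

Lemma truncn_ratio_cvg : (Num.truncn (phi n))%:R / phi n @[n --> \oo] --> (1 : R).
Proof.
have phi0 : \forall n \near \oo, 0 < phi n by have /cvgryPgt/(_ 0) := phi_y.
apply: (@squeeze_cvgr _ _ _ _ (fun n => 1 - (phi n)^-1) (fun=> 1)); last 2 first.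
- rewrite -[X in _ --> X]subr0; apply: cvgB; first exact: cvg_cst.
  by apply/(gtr0_cvgV0 phi0).
- exact: cvg_cst.
near=> n.
have p0 : 0 < phi n by near: n.
have /andP[h1 h2] := truncn_itv (ltW p0).
rewrite ler_pdivrMr// mul1r h1 andbT ler_pdivlMr// mulrBl mulVf ?gt_eqF// mul1r.
by rewrite lerBlDr natr1 ltW.
Unshelve. all: by end_near. Qed.

End TruncnAsymptotics.

(* At s = 1 the term (1 - s) `^ (1 + alpha) * L (1 - s) is 0, whatever L 0 is,
   since 0 `^ (1 + alpha) = 0. *)
Theorem theorem1 (R : realType) (d : measure_display) (T : measurableType d)
    (P : probability T R) (alpha : R) (xi : {RV P >-> nat})
    (Z : nat -> {RV P >-> nat}) (L : R -> R) (phi : nat -> R)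
    (halpha : 0 < alpha < 1)
    (hZ : Galton_Watson xi Z)
    (hmean : ('E_P[fun w => ((xi w)%:R)%R] = 1)%E)
    (hL : slowly_varying_at0 L)
    (hf : forall s : R, 0 <= s <= 1 ->
       pgf xi s = s + (1 - s) `^ (1 + alpha) * L (1 - s))
    (hphi_gt0 : forall n : nat, (1 <= n)%N -> 0 < phi n)
    (hphi_infty : phi n @[n --> \oo] --> +oo)
    (hphi_o : phi n / n%:R @[n --> \oo] --> (0 : R)) :
  asymp_equiv
    (fun n => fine (P (small_population (pgf xi) Z phi n)))
    (fun n => (1 - iter n (pgf xi) 0) / (alpha * n%:R) *
              (1 / Gamma (1 + alpha)) * phi n).
Proof.
have [X [Xindep Xdist Z0 ZS]] := hZ.
have pgfZ n s : 0 <= s <= 1 -> pgf (Z n) s = iter n (pgf xi) s.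
  by move=> s01; exact: (pgf_Z Xindep Xdist Z0 ZS).
have m_y := truncn_cvgy hphi_infty.
have mphi := truncn_ratio_cvg hphi_infty.
have phi0 : \forall n \near \oo, 0 < phi n by have /cvgryPgt/(_ 0) := hphi_infty.
have m_small : (Num.truncn (phi n))%:R / n%:R @[n --> \oo] --> (0 : R).
  have : (Num.truncn (phi n))%:R / phi n * (phi n / n%:R) @[n --> \oo] --> 1 * (0 : R).
    exact: cvgM.
  rewrite mulr0; apply: cvg_trans; apply: near_eq_cvg; near=> n.
  have p0 : 0 < phi n by near: n.
  have n0 : 0 < n%:R :> R by rewrite ltr0n; near: n; exact: nbhs_infty_gt.
  by field; rewrite !gt_eqF.
have G0 := Gamma_gt0 halpha.
have a0 : 0 < alpha by case/andP: halpha.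
have cv := mean_small_cvg halpha hL hf pgfZ m_y m_small.
(* The factor [Gamma (1 + alpha)] normalizes the limit to 1, and the last factor replaces the
   integer part of [phi n] in the denominator by [phi n] itself. *)
have : mean P (Z n) \1_(small alpha L (fun n => Num.truncn (phi n)) n) /
    (decay_seq (reg_var alpha L) n / (alpha * n%:R) * (Num.truncn (phi n))%:R) *
    Gamma (1 + alpha) * ((Num.truncn (phi n))%:R / phi n)
    @[n --> \oo] --> (Gamma (1 + alpha))^-1 * Gamma (1 + alpha) * 1.
  by apply: cvgM => //; apply: cvgMl.
rewrite mulVf ?gt_eqF// mulr1; apply: cvg_trans; apply: near_eq_cvg; near=> n.
have p0 : 0 < phi n by near: n.
have n0 : 0 < n%:R :> R by rewrite ltr0n; near: n; exact: nbhs_infty_gt.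
have m0 : 0 < (Num.truncn (phi n))%:R :> R.
  by rewrite ltr0n; near: n; have /cvgnyPge/(_ 1%N) := m_y.
have q0 : 0 < decay_seq (reg_var alpha L) n.
  exact: (Q_gt0 (reg_var_gt0 alpha hL) (reg_var_lt1 halpha hL hf)).
rewrite mean_indic; last exact: measurable_funP.
have -> : small_population (pgf xi) Z phi n =
    Z n @^-1` small alpha L (fun n => Num.truncn (phi n)) n.
  by apply/seteqP; split => w; rewrite /small_population /small/= (survival halpha hL hf).
rewrite (survival halpha hL hf); field; rewrite !gt_eqF//.
Unshelve. all: by end_near. Qed.
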